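(* Let $m(n)$ be integers with $m(n)\le 3n-6$ and $m(n)=3n-o(n)$. Then \[ \mathbf{P}[P_{n,m}\text{ is connected}]\to 1 \quad\text{as } n\to\infty. \]
   Context: $\mathcal{P}(n,m)$ denotes the set of all (simple, labelled) planar graphs on the vertex set $\{1,2,\ldots,n\}$ with exactly $m$ edges, and $P_{n,m}$ denotes a graph chosen uniformly at random from $\mathcal{P}(n,m)$. *)

(* Defs.v *)
From HB Require Import structures.
From mathcomp Require Import all_boot all_order all_algebra.
From mathcomp Require Import all_classical all_reals all_analysis.
Set Implicit Arguments.
Unset Strict Implicit.
Unset Printing Implicit Defensive.
Import Order.TTheory GRing.Theory Num.Theory.
Import numFieldNormedType.Exports.
Local Open Scope classical_set_scope.
Local Open Scope ring_scope.

(* A labelled graph on 'I_n is given by its edge set; it is simple when every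
   edge is a set of exactly two vertices. *)
Definition simple_graph (n : nat) (E : {set {set 'I_n}}) : bool :=
  [forall e in E, #|e| == 2%N].

Definition adj (n : nat) (E : {set {set 'I_n}}) : rel 'I_n :=
  fun u v => [set u; v]%SET \in E.

Definition connected_graph (n : nat) (E : {set {set 'I_n}}) : bool :=
  [forall u, forall v, connect (adj E) u v].

(* A parametrised simple arc in the plane; only the values on [0, 1] matter. *)
Definition simple_arc (R : realType) (g : R -> R * R) : Prop :=
  {within `[0, 1], continuous g} /\ {in `[0, 1] &, injective g}.

(* A crossing-free drawing: pos v is the point representing v, and arc e the
   arc representing e, so that arcs meet only at common end vertices. *)
Definition plane_drawing (R : realType) (n : nat) (E : {set {set 'I_n}})
    (pos : 'I_n -> R * R) (arc : {set 'I_n} -> R -> R * R) : Prop :=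
  [/\ injective pos,
      forall e, e \in E -> simple_arc (arc e),
      forall e, e \in E -> [set arc e 0; arc e 1] = pos @` [set` e],
      forall e v t, e \in E -> t \in `]0, 1[ -> arc e t <> pos v &
      forall e f s t, e \in E -> f \in E -> e <> f ->
        s \in `]0, 1[ -> t \in `]0, 1[ -> arc e s <> arc f t].

Definition planar (R : realType) (n : nat) (E : {set {set 'I_n}}) : Prop :=
  exists pos arc, @plane_drawing R n E pos arc.

(* m is an integer: there is no such graph when m < 0. *)
Definition planar_graphs (R : realType) (n : nat) (m : int) :
    {set {set {set 'I_n}}} :=
  [set E : {set {set 'I_n}} |
     [&& simple_graph E, `[< planar R E >] & #|E|%:Z == m]]%SET.

(* Probability that a uniformly random element of S lies in A; the value is 0
   when S is empty. *)
Definition uniform_prob (R : realType) (T : finType) (S : {set T})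
    (A : pred T) : R :=
  #|[set x in S | A x]%SET|%:R / #|S|%:R.

Definition prob_connected (R : realType) (n : nat) (m : int) : R :=
  uniform_prob R (planar_graphs R n m) (@connected_graph n).

(* Main.v *)
(** Let [E] be planar with [3n - s] edges, [s = o(n)].  Double counting compares
    the disconnected graphs with all graphs in the class: delete an arc [xz]
    lying in a triangle [xyz] with [y] of bounded degree, and insert an edge [ab]
    between two components.  There are linearly many choices for [xz] and at
    least [n] for [ab].  Conversely [ab] is a bridge of the new graph, which has
    at most [s] bridges, and [xz] is a pair of neighbours of a vertex of bounded
    degree, which leaves [O(n)] choices.  So a proportion [O(s / n)] is
    disconnected.

    The combinatorial estimates use only that planar graphs have no [K5] minor
    and no [K3,3] subgraph.  Both are excluded without the Jordan curve theorem:
    for paths [g] from [i] to [j] and [h] from [k] to [l] with disjoint ranges,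
    lifting the direction of [g s - h t] to the square gives a linear relation
    between the winding angles of [g] about [k], [l] and of [h] about [i], [j];
    the sum of these relations over all independent pairs fails modulo two full
    turns.

    An edge [ab] can be inserted since either component can be redrawn with [a],
    resp. [b], exposed to infinity: redraw a small disc about [a] with radial
    segments and invert at a free point of it. *)

Require Import Defs.
From HB Require Import structures.
From mathcomp Require Import all_boot all_order all_algebra.
From mathcomp Require Import zify.
Set Implicit Arguments.
Unset Strict Implicit.
Unset Printing Implicit Defensive.

(** * Minors and the number of edges *)

(** Euler's formula would need faces, so it is replaced by the bound [6 * (#|S| - 1)] on the arcs of
    every minor, that is 3(n - 1) edges; the loss against 3n - 6 disappears in [s]. Being
    near-extremal is then used only through this bound: a modification that removes a vertex
    together with fewer than three edges uses up slack, so only O(s) independent ones can exist.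
    This limits the bridges, the vertices of degree at most 2, and any induced matching of edges
    outside all triangles. The delicate point is that the third vertex [y] of the triangle must have
    bounded degree, since after the deletion [xz] can be found only through [y]. This asks for
    linearly many edges with both ends of bounded degree, and the obstacle is a vertex all of whose
    neighbours have large degree; the excluded subgraphs and minors make vertices with three such
    neighbours rare. *)

Section Arcs.
Variable T : finType.
Implicit Types (H : rel T) (S : {set T}).

Definition nbrs H S x : {set T} := [set z in S | H x z].
Definition arcs H S : {set T * T} := [set p | [&& p.1 \in S, p.2 \in S & H p.1 p.2]].

Lemma card_arcs H S : #|arcs H S| = \sum_(x in S) #|nbrs H S x|.
Proof.
rewrite -sum1_card (eq_bigl (fun p : T * T => (p.1 \in S) && ((p.2 \in S) && H p.1 p.2))); last first.
  by move=> p; rewrite inE.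
rewrite -(pair_big_dep (mem S) (fun i j => (j \in S) && H i j) (fun _ _ => 1)) /=.
by apply: eq_bigr => x _; rewrite -sum1_card; apply: eq_bigl => y; rewrite inE.
Qed.

Lemma nbrsD1 H S x y : #|nbrs H S x| = #|nbrs H (S :\ y) x| + (y \in nbrs H S x).
Proof.
have -> : nbrs H (S :\ y) x = nbrs H S x :\ y by apply/setP=> z; rewrite !inE andbA.
by rewrite addnC [LHS](cardsD1 y).
Qed.

Lemma card_arcsD1 H S y : symmetric H -> irreflexive H -> y \in S ->
  #|arcs H S| = #|arcs H (S :\ y)| + 2 * #|nbrs H S y|.
Proof.
move=> symH irrH yS; rewrite !card_arcs (big_setD1 y) //=.
have -> : \sum_(x in S :\ y) #|nbrs H S x|
          = \sum_(x in S :\ y) (#|nbrs H (S :\ y) x| + (y \in nbrs H S x)).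
  by apply: eq_bigr => x _; exact: nbrsD1.
rewrite big_split /=.
suff -> : \sum_(x in S :\ y) (y \in nbrs H S x : nat) = #|nbrs H S y| by lia.
rewrite -sum1_card big_mkcond [RHS]big_mkcond; apply: eq_bigr => x _.
rewrite !inE yS (symH y x) /=; case: (eqVneq x y) => [->|] //=; first by rewrite irrH andbF.
by case: (x \in S) => //=; case: (H x y).
Qed.

Lemma arcs_sub H S S' : S' \subset S -> arcs H S' \subset arcs H S.
Proof.
move=> /subsetP sS; apply/subsetP=> p; rewrite !inE => /and3P[p1 p2 ->].
by rewrite !sS.
Qed.

Lemma exists_low_degree H S k : #|arcs H S| < k * #|S| -> exists2 x, x \in S & #|nbrs H S x| < k.
Proof.
move=> lt; apply/exists_inP; apply: contraLR lt => /exists_inPn h.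
rewrite -leqNgt card_arcs mulnC -sum_nat_const; apply: leq_sum => x xS.
by rewrite leqNgt h.
Qed.

(** [x] absorbs [y]. The relation lives on the whole type and [y] is discarded by restricting to
    [S :\ y]; the test [u != v] removes the loop that the edge [xy] would leave. *)
Definition contract H x y : rel T :=
  fun u v => (u != v) && [|| H u v, (u == x) && H y v | (v == x) && H u y].

Lemma contract_sym H x y : symmetric H -> symmetric (contract H x y).
Proof.
move=> symH u v; rewrite /contract (eq_sym u v) (symH u v) (symH u y) (symH y v).
by congr (_ && (_ || _)); rewrite orbC.
Qed.

Lemma contract_irr H x y : irreflexive (contract H x y).
Proof. by move=> u; rewrite /contract eqxx. Qed.

(** Besides the edge [xy] itself, only the edges to a common neighbour of [x] and [y] are lost, as
    they merge in pairs. *)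
Lemma card_arcs_contract H S x y : symmetric H -> irreflexive H ->
    x \in S -> y \in S -> H x y ->
  #|arcs H S| <= #|arcs (contract H x y) (S :\ y)|
                 + 2 * (#|nbrs H S x :&: nbrs H S y|).+1.
Proof.
move=> symH irrH xS yS Hxy.
have xNy : x != y by apply/eqP=> exy; rewrite exy irrH in Hxy.
rewrite (card_arcsD1 symH irrH yS) (card_arcsD1 symH irrH (y := x)); last by rewrite !inE xNy.
rewrite (card_arcsD1 (contract_sym x y symH) (contract_irr H x y) (y := x)); last by rewrite !inE xNy.
have sub : #|arcs H ((S :\ y) :\ x)| <= #|arcs (contract H x y) ((S :\ y) :\ x)|.
  apply/subset_leq_card/subsetP=> p; rewrite !inE => /and3P[-> -> Hp] /=.
  by rewrite /contract Hp andbT; apply/eqP=> e; rewrite e irrH in Hp.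
have -> : nbrs (contract H x y) (S :\ y) x = (nbrs H S x :|: nbrs H S y) :\ x :\ y.
  apply/setP=> z; rewrite !inE /contract eqxx /= (eq_sym z x) Hxy.
  case: (eqVneq x z) => [<-|xz] /=; first by rewrite !andbF.
  by case: (z \in S); case: (z == y); case: (H x z); case: (H y z).
have := nbrsD1 H S x y; rewrite inE yS Hxy /=.
set A := nbrs H S x; set B := nbrs H S y => cA.
have := cardsD1 x (A :|: B); have := cardsD1 y ((A :|: B) :\ x).
rewrite !inE yS xS Hxy (eq_sym y x) (negbTE xNy) irrH (symH y x) Hxy /= => e1 e2.
have := cardsUI A B; rewrite /= in sub *; lia.
Qed.

End Arcs.

Section Minors.
Variables (V : finType) (g : rel V).
Hypothesis symg : symmetric g.

Definition restr (T : finType) (h : rel T) (X : {set T}) : rel T :=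
  fun u v => [&& u \in X, v \in X & h u v].

Definition conn (X : {set V}) : Prop :=
  forall x y, x \in X -> y \in X -> connect (restr g X) x y.

(** An empty branch set counts as connected; a vertex that has an [H]-neighbour gets a nonempty one
    from [minor_adj]. *)
Record minor (T : finType) (H : rel T) (S : {set T}) (B : T -> {set V}) : Prop := Minor {
  minor_conn : forall x, x \in S -> conn (B x);
  minor_disj : forall x y z, x \in S -> y \in S -> z \in B x -> z \in B y -> x = y;
  minor_adj : forall x y, x \in S -> y \in S -> H x y ->
     exists u v, [/\ u \in B x, v \in B y & g u v] }.

Definition K5_free : Prop :=
  forall B : 'I_5 -> {set V}, ~ minor (fun i j => i != j) [set: 'I_5] B.

Lemma restr_sym (T : finType) (h : rel T) (X : {set T}) : symmetric h -> symmetric (restr h X).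
Proof. by move=> symh u v; rewrite /restr symh andbCA. Qed.

Lemma restr_sub (T : finType) (h : rel T) (X Y : {set T}) u v :
  X \subset Y -> connect (restr h X) u v -> connect (restr h Y) u v.
Proof.
move=> /subsetP XY; apply: connect_sub => a b /and3P[aX bX hab]; apply: connect1.
by rewrite /restr !XY.
Qed.

Lemma conn1 x : conn [set x].
Proof. by move=> a b; rewrite !inE => /eqP-> /eqP->; exact: connect0. Qed.

Lemma connU X Y u v : conn X -> conn Y -> u \in X -> v \in Y -> g u v -> conn (X :|: Y).
Proof.
move=> cX cY uX vY guv.
have symc := sym_connect_sym (restr_sym (X :|: Y) symg).
have toX a : a \in X -> connect (restr g (X :|: Y)) a u.
  by move=> aX; apply: restr_sub (subsetUl _ _) (cX _ _ aX uX).
have toY a : a \in Y -> connect (restr g (X :|: Y)) a v.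
  by move=> aY; apply: restr_sub (subsetUr _ _) (cY _ _ aY vY).
have uv : connect (restr g (X :|: Y)) u v.
  by apply: connect1; rewrite /restr !inE uX vY guv orbT.
have tou a : a \in X :|: Y -> connect (restr g (X :|: Y)) a u.
  rewrite inE => /orP[/toX //|/toY av]; apply: connect_trans av _.
  by rewrite symc.
by move=> a b aS bS; apply: connect_trans (tou a aS) _; rewrite symc; exact: tou.
Qed.

Lemma minor_mono (T : finType) (H H' : rel T) (S S' : {set T}) B :
  S' \subset S -> (forall x y, x \in S' -> y \in S' -> H' x y -> H x y) ->
  minor H S B -> minor H' S' B.
Proof.
move=> /subsetP sS sH [c d a]; split.
- by move=> x /sS; exact: c.
- by move=> x y z /sS xS /sS yS; exact: d.
- by move=> x y xS yS /(sH _ _ xS yS); apply: a; exact: sS.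
Qed.

Lemma minor_contract (T : finType) (H : rel T) (S : {set T}) B x y :
    symmetric H -> x \in S -> y \in S -> x != y -> H x y -> minor H S B ->
  minor (contract H x y) (S :\ y) (fun z => if z == x then B x :|: B y else B z).
Proof.
move=> symH xS yS xNy Hxy [c d a]; split.
- move=> z; rewrite !inE => /andP[zNy zS]; case: ifP => _; last exact: c.
  have [u [v [uB vB guv]]] := a _ _ xS yS Hxy.
  by apply: connU (c _ xS) (c _ yS) uB vB guv.
- move=> u v z; rewrite !inE => /andP[uNy uS] /andP[vNy vS].
  case: (eqVneq u x) => [->|ux]; case: (eqVneq v x) => [->|vx] //.
  + rewrite inE => /orP[] h1 h2; first exact: d h1 h2.
    by rewrite (d _ _ _ yS vS h1 h2) eqxx in vNy.
  + rewrite inE => h1 /orP[] h2; first exact: d h1 h2.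
    by rewrite (d _ _ _ uS yS h1 h2) eqxx in uNy.
  + exact: d.
- move=> u v; rewrite !inE => /andP[uNy uS] /andP[vNy vS] /andP[uv].
  move=> /or3P[Huv|/andP[/eqP ex Hyv]|/andP[/eqP ex Huy]].
  + have [p [q [pB qB gpq]]] := a _ _ uS vS Huv; exists p, q; split=> //.
      by case: ifP => // /eqP <-; rewrite inE pB.
    by case: ifP => // /eqP <-; rewrite inE qB.
  + have [p [q [pB qB gpq]]] := a _ _ yS vS Hyv; exists p, q; split=> //.
      by rewrite ex eqxx inE pB orbT.
    by case: ifP => // /eqP <-; rewrite inE qB.
  + have [p [q [pB qB gpq]]] := a _ _ uS yS Huy; exists p, q; split=> //.
      by case: ifP => // /eqP <-; rewrite inE pB.
    by rewrite ex eqxx inE qB orbT.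
Qed.

Hypothesis K5f : K5_free.

Lemma no_5_clique (T : finType) (H : rel T) (S : {set T}) B (s : seq T) :
  symmetric H -> minor H S B -> size s = 5 -> {subset s <= S} -> uniq s ->
  pairwise H s -> False.
Proof.
move=> symH [c d a] sz sS us pw.
have [x0 _] : exists x, x \in s by case: s sz {sS us pw} => // x s _; exists x; rewrite mem_head.
have inS (i : 'I_5) : nth x0 s i \in S by apply: sS; rewrite mem_nth // sz.
apply: (K5f (B := fun i => B (nth x0 s i))); split.
- by move=> i _; exact: c.
- move=> i j z _ _ zi zj; have := d _ _ _ (inS i) (inS j) zi zj.
  by move/eqP; rewrite nth_uniq ?sz // => /eqP/val_inj.
- move=> i j _ _ iNj; apply: a => //.
  have /(pairwiseP x0) P := pw.
  case: (ltngtP i j) => [lt|lt|/val_inj e]; last by rewrite e eqxx in iNj.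
    by apply: P; rewrite ?inE ?sz.
  by rewrite symH; apply: P; rewrite ?inE ?sz.
Qed.

End Minors.

Definition sym5 (b01 b02 b03 b04 b12 b13 b14 b23 b24 b34 : bool) : nat -> nat -> bool :=
  fun i j => nth false (nth [::]
    [:: [:: false; b01; b02; b03; b04]; [:: b01; false; b12; b13; b14];
        [:: b02; b12; false; b23; b24]; [:: b03; b13; b23; false; b34];
        [:: b04; b14; b24; b34; false]] i) j.

(* [a], [b], [c], [d], [e] are listed so that only [ab] and [de] may be missing;
   merging [a] with [d] turns the rest into a clique. *)
Definition spread5 (T : Type) (h : T -> T -> bool) (x0 : T) (s : seq T) : bool :=
  let a := nth x0 s 0 in let b := nth x0 s 1 in let c := nth x0 s 2 in
  let d := nth x0 s 3 in let e := nth x0 s 4 in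
  [&& h a c, h b c, h c d, h c e, h a d, h a e, h b d & h b e].

(** Among five vertices, degree at least 3 leaves each vertex at most one non-neighbour, so the
    missing edges form a matching of size at most 2. The ten booleans run over all graphs on five
    vertices, and each is settled by computation. *)
Lemma spread5_sym5 b01 b02 b03 b04 b12 b13 b14 b23 b24 b34 :
  let h := sym5 b01 b02 b03 b04 b12 b13 b14 b23 b24 b34 in
  all (fun i => 3 <= count (h i) (iota 0 5)) (iota 0 5) ->
  has (spread5 h 0) (permutations (iota 0 5)).
Proof.
by move: b01 b02 b03 b04 b12 b13 b14 b23 b24 b34; do 10!case; vm_compute.
Qed.

Lemma count_enum (T : finType) (A : {set T}) (P : pred T) :
  count P (enum A) = #|[set z in A | P z]|.
Proof.
rewrite -size_filter -(card_uniqP _); last by rewrite filter_uniq ?enum_uniq.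
by apply: eq_card => z; rewrite mem_filter mem_enum !inE andbC.
Qed.

Lemma spread5_seq (T : eqType) (h : rel T) x0 (s : seq T) :
  symmetric h -> irreflexive h -> size s = 5 ->
  (forall x, x \in s -> 3 <= count (h x) s) ->
  exists2 s', perm_eq s' s & spread5 h x0 s'.
Proof.
move=> symh irrh sz cnt.
have es : s = map (nth x0 s) (iota 0 5) by rewrite -sz -/(mkseq _ _) mkseq_nth.
pose k i j := h (nth x0 s i) (nth x0 s j).
pose k' := sym5 (k 0 1) (k 0 2) (k 0 3) (k 0 4) (k 1 2) (k 1 3) (k 1 4) (k 2 3) (k 2 4) (k 3 4).
have kk' : {in iota 0 5 &, forall i j, k' i j = k i j}.
  move=> i j; rewrite !mem_iota /= !add0n => iI jI; rewrite /k' /k.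
  move: i j iI jI => [|[|[|[|[|i]]]]] [|[|[|[|[|j]]]]] iI jI //=.
have /hasP[p] : has (spread5 k' 0) (permutations (iota 0 5)).
  apply: spread5_sym5; apply/allP=> i iI.
  have -> : count (k' i) (iota 0 5) = count (h (nth x0 s i)) s.
    rewrite {2}es count_map; apply: eq_in_count => j jI; exact: kk'.
  by apply: cnt; rewrite mem_nth // sz; move: iI; rewrite mem_iota.
rewrite mem_permutations => pp sp.
exists (map (nth x0 s) p); first by rewrite [X in perm_eq _ X]es perm_map.
have szp : size p = 5 by rewrite (perm_size pp).
have inp i : i < 5 -> nth 0 p i \in iota 0 5.
  by move=> lt; rewrite -(perm_mem pp) mem_nth // szp.
move: sp; rewrite /spread5 !(nth_map 0) ?szp //.
by rewrite !kk' ?inp.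
Qed.

(** * Mader's bound on the edges of a graph without a K5 minor *)

Section EdgeBound.
Variables (V : finType) (g : rel V).
Hypotheses (symg : symmetric g) (K5f : K5_free g).

(* Mader's argument: in a smallest counterexample every vertex has degree at
   least 4 and every edge lies in three triangles, so that the neighbourhood of
   a vertex of degree at most 5 is complete up to a matching. *)
Lemma edge_bound (T : finType) (H : rel T) (S : {set T}) B :
  symmetric H -> irreflexive H -> minor g H S B -> #|arcs H S| <= 6 * (#|S| - 1).
Proof.
(* The induction runs over all minors of [g], by the number of vertices and then by the number of
   arcs, so that it covers both contraction and deletion of an edge. *)
have [n] := ubnP #|S|; elim: n => // n IHS in H S B *.
have [k] := ubnP #|arcs H S|; elim: k => // k IH in H S B * => ltk ltn symH irrH mB.
rewrite leqNgt; apply/negP=> lt.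
have [[u v]] : exists p, p \in arcs H S by apply/set0Pn; rewrite -card_gt0; lia.
rewrite inE /= => /and3P[uS vS Huv].
have uNv : u != v by apply/eqP=> e; rewrite e irrH in Huv.
have S2 : 1 < #|S| by rewrite (cardsD1 u) uS (cardsD1 v) !inE eq_sym uNv vS.
(* Deleting the edge [uv] drops only two arcs, so a minimal counterexample exceeds the bound by at
   most 2; this yields the vertex [v0] of degree at most 5 below. *)
have le2 : #|arcs H S| <= 6 * (#|S| - 1) + 2.
  rewrite leqNgt; apply/negP=> lt2.
  pose uv : {set T * T} := [set (u, v); (v, u)].
  pose H' : rel T := fun x y => H x y && ((x, y) \notin uv).
  have symuv x y : ((x, y) \in uv) = ((y, x) \in uv).
    by rewrite !inE !xpair_eqE orbC (andbC (x == u)) (andbC (x == v)).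
  have eA : arcs H' S = arcs H S :\: uv.
    by apply/setP=> -[x y]; rewrite !inE /H' /= !inE [RHS]andbC -!andbA.
  have c1 : #|arcs H S| <= #|arcs H' S| + 2.
    rewrite eA -(cardsID uv (arcs H S)) addnC leq_add2l.
    apply: leq_trans (subset_leq_card (subsetIr _ _)) _.
    by rewrite cards2; case: eqP.
  have c2 : #|arcs H' S| < #|arcs H S|.
    rewrite eA; apply: proper_card; apply/properP; split; first exact: subsetDl.
    by exists (u, v); rewrite !inE /= ?uS ?vS ?eqxx.
  suff : #|arcs H' S| <= 6 * (#|S| - 1) by lia.
  apply: (IH H' S B); try lia.
  - by move=> x y; rewrite /H' symH symuv.
  - by move=> x; rewrite /H' irrH.
  - by apply: minor_mono mB => // x y _ _ /andP[].
have deg4 y : y \in S -> 3 < #|nbrs H S y|.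
  move=> yS; have cS := cardsD1 y S; rewrite yS in cS.
  have cA := card_arcsD1 symH irrH yS.
  suff : #|arcs H (S :\ y)| <= 6 * (#|S :\ y| - 1) by lia.
  have sub := subset_leq_card (arcs_sub H (subD1set S y)).
  by apply: (IHS _ _ B) => //; [lia | apply: minor_mono mB; rewrite ?subD1set].
have tri x y : x \in S -> y \in S -> H x y -> 2 < #|nbrs H S x :&: nbrs H S y|.
  move=> xS yS Hxy; have cS := cardsD1 y S; rewrite yS in cS.
  have cA := card_arcs_contract symH irrH xS yS Hxy.
  have xNy : x != y by apply/eqP=> e; rewrite e irrH in Hxy.
  suff : #|arcs (contract H x y) (S :\ y)| <= 6 * (#|S :\ y| - 1) by lia.
  have cS' : #|S :\ y| < n by lia.
  apply: (IHS _ _ _ cS' (contract_sym x y symH) (contract_irr H x y)).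
  exact: (minor_contract symg symH xS yS xNy Hxy mB).
have [v0 v0S deg5] : exists2 x, x \in S & #|nbrs H S x| < 6 by apply: exists_low_degree; lia.
have := deg4 _ v0S.
set N := nbrs H S v0 in deg5 *; set s := enum N => deg3.
have us : uniq s by exact: enum_uniq.
have sN x : (x \in s) = (x \in S) && H v0 x by rewrite mem_enum inE.
have szs : size s = #|N| by rewrite cardE.
have cnt x : x \in s -> 3 <= count (H x) s.
  rewrite sN => /andP[xS Hvx]; rewrite count_enum.
  rewrite (_ : [set z in N | H x z] = nbrs H S v0 :&: nbrs H S x); first exact: tri.
  by apply/setP=> z; rewrite !inE; case: (z \in S); case: (H v0 z).
have all0 : all (H v0) s by apply/allP=> x; rewrite sN => /andP[].
have v0s : v0 \notin s by rewrite sN irrH andbF.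
have sS : {subset s <= S} by move=> x; rewrite sN => /andP[].
have [sz4|sz5] : size s = 4 \/ size s = 5 by lia.
  apply: (no_5_clique K5f symH mB (s := v0 :: s)); rewrite /= ?sz4 ?v0s ?all0 //.
    by move=> x; rewrite inE => /orP[/eqP->|/sS].
  move: (cnt); rewrite -/s; case: (s) sz4 => [|a [|b [|c [|d [|]]]]] //= _ C.
  move: (C a) (C b) (C c); rewrite !inE !eqxx !orbT !irrH /= => /(_ isT) Ha /(_ isT) Hb /(_ isT) Hc.
  move: Ha Hb Hc; rewrite (symH b a).
  by case: (H a b); case: (H a c); case: (H a d); case: (H b c); case: (H b d);
    case: (H c d); case: (H c a); case: (H c b).
have [s' ps] := spread5_seq v0 symH irrH sz5 cnt.
have us' : uniq s' by rewrite (perm_uniq ps).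
have sz' : size s' = 5 by rewrite (perm_size ps).
have s'S : {subset s' <= S} by move=> x; rewrite (perm_mem ps); exact: sS.
have v0s' : v0 \notin s' by rewrite (perm_mem ps).
have all0' : all (H v0) s' by rewrite (perm_all _ ps).
case: s' us' sz' s'S v0s' all0' {ps} => [|a [|b [|c [|d [|e [|]]]]]] // us' _ s'S v0s' all0'.
rewrite /spread5 /= => /and5P[Hac Hbc Hcd Hce /and4P[Had Hae Hbd Hbe]].
have aS : a \in S by apply: s'S; rewrite !inE eqxx.
have dS : d \in S by apply: s'S; rewrite !inE eqxx !orbT.
have aNd : a != d by apply/eqP=> E; rewrite E irrH in Had.
have mB' := minor_contract symg symH aS dS aNd Had mB.
move: us' v0s' all0'; rewrite /= !inE !negb_or => /and5P[/and4P[ab ac ad ae] /and3P[bc bd be] /andP[cd ce] de _]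
  /and5P[va vb vc vd ve] /and5P[H0a H0b H0c H0d /andP[H0e _]].
apply: (no_5_clique K5f (contract_sym a d symH) mB' (s := [:: v0; a; b; c; e])) => //.
- have dN : d \notin [:: v0; a; b; c; e].
    by rewrite !inE !negb_or !(eq_sym d) vd ad bd cd eq_sym de.
  move=> x xin; rewrite in_setD1; apply/andP; split; first by apply: contraNneq dN => <-.
  by move: xin; rewrite inE => /orP[/eqP->//|]; rewrite !inE => /or4P[]/eqP->; apply: s'S; rewrite !inE eqxx ?orbT.
- by rewrite /= !inE !negb_or va vb vc ve ab ac ae bc be ce.
- rewrite /= /contract va vb vc ve ab ac ae bc be ce !eqxx H0a H0b H0c H0e (symH d b).
  by rewrite Hac Hbc Hce Hae Hbd Hbe !orbT.
Qed.
End EdgeBound.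

(** * Bridges *)

Lemma card_bigcup_leq (I T : finType) (P : {set I}) (F : I -> {set T}) k :
  (forall i, i \in P -> #|F i| <= k) -> #|\bigcup_(i in P) F i| <= #|P| * k.
Proof.
move=> Fk; rewrite -sum_nat_const.
apply: (@leq_trans (\sum_(i in P) #|F i|)); last exact: leq_sum.
elim/big_rec2: _ => [|i n A _ le]; first by rewrite cards0.
by apply: leq_trans (leq_card_setU _ _) _; rewrite leq_add2l.
Qed.

Lemma card_dep_pairs (I T : finType) (P : {set I}) (F : I -> {set T}) :
  #|[set p : I * T | (p.1 \in P) && (p.2 \in F p.1)]| = \sum_(i in P) #|F i|.
Proof.
rewrite -sum1_card.
rewrite (eq_bigl (fun p : I * T => (p.1 \in P) && (p.2 \in F p.1))); last by move=> p; rewrite inE.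
rewrite -(pair_big_dep (mem P) (fun i j => j \in F i) (fun _ _ => 1)) /=.
by apply: eq_bigr => x _; rewrite sum1_card.
Qed.

Lemma card_dep_pairs_leq (I T : finType) (P : {set I}) (F : I -> {set T}) k :
  (forall i, i \in P -> #|F i| <= k) ->
  #|[set p : I * T | (p.1 \in P) && (p.2 \in F p.1)]| <= #|P| * k.
Proof. by move=> Fk; rewrite card_dep_pairs -sum_nat_const; exact: leq_sum. Qed.

Section Bridges.
Variables (T : finType) (H : rel T).
Hypotheses (symH : symmetric H) (irrH : irreflexive H).

(** Edges are compared as unordered pairs, so both orientations of [p] are cut, and [bridges] counts
    every bridge in both directions. *)
Definition cut (S : {set T}) (p : T * T) : rel T :=
  fun u v => [&& u \in S, v \in S, H u v & [set u; v] != [set p.1; p.2]].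

Definition bridges (S : {set T}) : {set T * T} :=
  [set p in arcs H S | ~~ connect (cut S p) p.1 p.2].

Lemma cut_sym S p : symmetric (cut S p).
Proof. by move=> u v; rewrite /cut symH setUC andbCA. Qed.

Lemma bridges_sub (S S' : {set T}) p : S' \subset S -> p \in arcs H S' -> p \in bridges S -> p \in bridges S'.
Proof.
move=> /subsetP sS pS'; rewrite !inE => /andP[_]; move: pS'; rewrite inE => -> /=.
apply: contraNN; apply: connect_sub => u v /and4P[uS vS Huv ne]; apply: connect1.
by rewrite /cut !sS // Huv.
Qed.

(* Splitting along a bridge leaves two parts to which induction applies. *)
Lemma bridges_bound (S : {set T}) : (forall S' : {set T}, S' \subset S -> #|arcs H S'| <= 6 * (#|S'| - 1)) ->
  #|arcs H S| + 2 * #|bridges S| <= 6 * (#|S| - 1).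
Proof.
have [n] := ubnP #|S|; elim: n => // n IH in S *; rewrite ltnS => leS sparse.
have [->|[[x y] br]] := set_0Vmem (bridges S); first by rewrite cards0 addn0 sparse.
pose c := cut S (x, y); pose S1 := [set z in S | connect c x z]; pose S2 := S :\: S1.
have symc : connect_sym c := sym_connect_sym (cut_sym S (x, y)).
have := br; rewrite !inE /= => /andP[/and3P[xS yS Hxy] ncxy].
have x1 : x \in S1 by rewrite inE xS connect0.
have y2 : y \in S2 by rewrite !inE yS (negbTE ncxy).
have s1 : S1 \subset S by apply/subsetP=> z; rewrite inE => /andP[].
have s2 : S2 \subset S by exact: subsetDl.
have c12 : #|S1| + #|S2| = #|S| by rewrite -(cardsID S1 S) (setIidPr s1).
have p1 : 0 < #|S1| by rewrite card_gt0; apply/set0Pn; exists x.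
have p2 : 0 < #|S2| by rewrite card_gt0; apply/set0Pn; exists y.
pose xy : {set T * T} := [set (x, y); (y, x)].
have cxy : #|xy| <= 2 by rewrite cards2; case: eqP.
have split u v : (u, v) \in arcs H S ->
    [|| (u, v) \in arcs H S1, (u, v) \in arcs H S2 | (u, v) \in xy].
  rewrite !inE /= => /and3P[uS vS Huv]; rewrite uS vS Huv /= !andbT.
  have [e|ne] := eqVneq [set u; v] [set x; y].
    have ux : u \in [set x; y] by rewrite -e !inE eqxx.
    have vx : v \in [set x; y] by rewrite -e !inE eqxx orbT.
    have uNv : u != v by apply/eqP=> E; rewrite E irrH in Huv.
    move: ux vx uNv; rewrite !inE !xpair_eqE.
    by case/orP=> /eqP->; case/orP=> /eqP->; rewrite ?eqxx ?orbT.
  have cuv : c u v by rewrite /c /cut uS vS Huv ne.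
  have -> : connect c x u = connect c x v.
    by rewrite !(symc x); apply: same_connect1.
  by case: (connect c x v).
have le_arcs : #|arcs H S| <= #|arcs H S1| + #|arcs H S2| + 2.
  apply: leq_trans (_ : #|arcs H S1 :|: arcs H S2 :|: xy| <= _).
    by apply/subset_leq_card/subsetP=> -[u v] /split; rewrite !in_setU orbA.
  apply: leq_trans (leq_card_setU _ _) _; apply: leq_add => //.
  exact: leq_card_setU.
have le_br : #|bridges S| <= #|bridges S1| + #|bridges S2| + 2.
  apply: leq_trans (_ : #|bridges S1 :|: bridges S2 :|: xy| <= _).
    apply/subset_leq_card/subsetP=> -[u v] b.
    have : (u, v) \in arcs H S by move: b; rewrite inE => /andP[].
    move=> /split /or3P[a|a|a]; last by apply/setUP; right.
      by apply/setUP; left; apply/setUP; left; exact: bridges_sub s1 a b.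
    by apply/setUP; left; apply/setUP; right; exact: bridges_sub s2 a b.
  apply: leq_trans (leq_card_setU _ _) _; apply: leq_add => //.
  exact: leq_card_setU.
have I1 : #|arcs H S1| + 2 * #|bridges S1| <= 6 * (#|S1| - 1).
  by apply: IH; [lia | move=> S' /subset_trans; auto].
have I2 : #|arcs H S2| + 2 * #|bridges S2| <= 6 * (#|S2| - 1).
  by apply: IH; [lia | move=> S' /subset_trans; auto].
(* The bridge [xy] contributes 2 as arcs and 2 * 2 as bridges; this total 6 is the difference
   between the bound for [S] and the sum of the bounds for [S1] and [S2]. *)
move: p1 p2 c12 le_arcs le_br I1 I2; rewrite /=; clear.
move: #|S1| #|S2| #|S| #|arcs H S1| #|arcs H S2| #|arcs H S| #|bridges S1| #|bridges S2| #|bridges S|.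
lia.
Qed.

End Bridges.

(** * Vertices with three neighbours in a small set *)

Section Triples.
Variables (V : finType) (g : rel V).
Hypotheses (symg : symmetric g) (irrg : irreflexive g) (K5f : K5_free g).

Definition K33_free : Prop := forall a b c, uniq [:: a; b; c] ->
  #|[set x | [&& g x a, g x b & g x c]]| <= 2.

Hypothesis K33f : K33_free.

Lemma conn_star a (X : {set V}) : {in X, forall x, g a x} -> conn g (a |: X).
Proof.
move=> gX.
have symc := sym_connect_sym (restr_sym (a |: X) symg).
have toa z : z \in a |: X -> connect (restr g (a |: X)) a z.
  rewrite !inE => /orP[/eqP->|zX]; first exact: connect0.
  by apply: connect1; rewrite /restr !inE eqxx zX gX // orbT.
by move=> u v uX vX; apply: connect_trans (toa v vX); rewrite symc; exact: toa.
Qed.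

Lemma K5_free_sparse (S : {set V}) : #|arcs g S| <= 6 * (#|S| - 1).
Proof.
apply: (@edge_bound _ _ symg K5f V g S (fun x => [set x])) => //; split.
- by move=> x _; exact: conn1.
- by move=> x y z _ _; rewrite !inE => /eqP <- /eqP.
- by move=> x y _ _ gxy; exists x, y; rewrite !inE.
Qed.

Variables (W X : {set V}).
Hypotheses (disjWX : forall x, x \in X -> x \notin W)
           (deg3 : forall x, x \in X -> 3 <= #|nbrs g W x|).

(* [(x, (a, b))] stands for the path [a - x - b]. *)
Let good (p : V * (V * V)) : bool :=
  [&& p.1 \in X, p.2.1 \in W, p.2.2 \in W, p.2.1 != p.2.2, g p.1 p.2.1 & g p.1 p.2.2].
(** Each middle vertex serves one path, and so does each pair of ends in either order; thus all
    members of a system can be contracted at once and give distinct edges. *)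
Let compat (p q : V * (V * V)) : bool :=
  (p == q) || [&& p.1 != q.1, p.2 != q.2 & p.2 != (q.2.2, q.2.1)].
Let system (F : {set V * (V * V)}) : bool :=
  [forall p in F, good p && [forall q in F, compat p q]].

(* Contracting [x] into [a] for every [(x, (a, b))] in [F] turns the pairs [ab] into edges. *)
Lemma system_bound F : system F ->
  let H := fun a b => [exists x, ((x, (a, b)) \in F) || ((x, (b, a)) \in F)] in
  (forall S : {set V}, S \subset W -> #|arcs H S| <= 6 * (#|S| - 1)) /\ #|F| <= 6 * #|W|.
Proof.
move=> /forall_inP sysF H.
have goodF p : p \in F -> good p by move=> /sysF /andP[].
have compF p q : p \in F -> q \in F -> compat p q by move=> /sysF /andP[_ /forall_inP]; apply.
have symH : symmetric H by move=> a b; rewrite /H; apply: eq_existsb => x; rewrite orbC.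
have irrH : irreflexive H.
  move=> a; apply/existsP=> -[x]; rewrite orbb => /goodF /and5P[_ _ _ /=].
  by rewrite eqxx.
pose B a := a |: [set x | [exists b, (x, (a, b)) \in F]].
have mB : minor g H W B.
  split.
  - move=> a _; apply: conn_star => x; rewrite inE => /existsP[b /goodF] /=.
    by case/and5P=> _ _ _ _ /andP[/=]; rewrite symg.
  - move=> a a' z aW a'W; rewrite !inE.
    case/orP=> [/eqP->|/existsP[b zF]]; case/orP=> [/eqP z_a'|/existsP[b' zF']].
    + by [].
    + by case/and5P: (goodF _ zF') => /= /disjWX; rewrite aW.
    + by case/and5P: (goodF _ zF) => /= /disjWX; rewrite z_a' a'W.
    + case/orP: (compF _ _ zF zF') => [/eqP[]//|/andP[/=]]; by rewrite eqxx.
  - move=> a b aW bW /existsP[x /orP[]] xF.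
      exists x, b; split; rewrite ?inE ?eqxx //.
        by apply/orP; right; apply/existsP; exists b.
      by case/and5P: (goodF _ xF) => _ _ _ _ /andP[].
    exists a, x; split; rewrite ?inE ?eqxx //.
      by apply/orP; right; apply/existsP; exists a.
    by case/and5P: (goodF _ xF) => _ _ _ _ /andP[_ /=]; rewrite symg.
have sparse (S : {set V}) : S \subset W -> #|arcs H S| <= 6 * (#|S| - 1).
  move=> sW; apply: (@edge_bound _ _ symg K5f V H S B) => //.
  by apply: (minor_mono sW _ mB).
split=> //.
apply: (@leq_trans #|arcs H W|); last by have := sparse _ (subxx W); lia.
rewrite -(card_in_imset (f := snd) (D := F)).
  apply/subset_leq_card/subsetP=> -[a b] /imsetP[[x p] xF /= ep]; rewrite -{}ep in xF.
  case/and5P: (goodF _ xF) => _ /= aW bW _ _; rewrite !inE aW bW /=.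
  by apply/existsP; exists x; rewrite xF.
move=> p q pF qF e; case/orP: (compF _ _ pF qF) => [/eqP//|/and3P[_]].
by rewrite e eqxx.
Qed.

(* For a maximal system, each remaining [x] has a triangle of contracted edges
   among its neighbours, and at most two vertices share three neighbours. *)
Lemma triple_bound : #|X| <= 56 * #|W|.
Proof.
have sys0 : system set0 by apply/forall_inP=> p; rewrite inE.
have [F /maxsetP[sysF maxF] _] := maxset_exists sys0.
have [sparse leF] := system_bound sysF.
pose H : rel V := fun a b => [exists x, ((x, (a, b)) \in F) || ((x, (b, a)) \in F)].
rewrite -/H in sparse.
move/forall_inP: (sysF) => sysF'.
pose X0 := [set p.1 | p in F].
have leX0 : #|X0| <= #|F| by exact: leq_imset_card.
have satur x a b : x \in X :\: X0 -> a \in nbrs g W x -> b \in nbrs g W x -> a != b -> H a b.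
  rewrite !inE => /andP[xX0 xX] /andP[aW gxa] /andP[bW gxb] aNb.
  case: (boolP (H a b)) => // nH; exfalso.
  have nab p : p \in F -> p.2 != (a, b) /\ p.2 != (b, a).
    case: p => y q yF; split; apply/eqP=> /= e; rewrite e in yF;
    by move/negP: nH; apply; apply/existsP; exists y; rewrite yF ?orbT.
  have nx p : p \in F -> p.1 != x.
    by move=> pF; apply: contraNneq xX0 => <-; apply/imsetP; exists p.
  suff sysxF : system ((x, (a, b)) |: F).
    have := maxF _ sysxF (subsetUr _ _) => /setP/(_ (x, (a, b))).
    by rewrite !inE eqxx /= => /esym /nx; rewrite eqxx.
  apply/forall_inP=> p; rewrite !inE => /orP[/eqP->|pF].
    rewrite /good /= xX aW bW aNb gxa gxb /=.
    apply/forall_inP=> q; rewrite !inE => /orP[/eqP->|qF]; first by rewrite /compat eqxx.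
    have [n1 n2] := nab _ qF.
    have n3 : (a, b) != (q.2.2, q.2.1).
      by move: n2; rewrite -!pair_eqE /= /pair_eq /= (eq_sym b) (eq_sym a) andbC.
    by rewrite /compat /= (eq_sym x) (nx _ qF) (eq_sym (a, b)) n1 n3 orbT.
  have /andP[gp /forall_inP cp] := sysF' _ pF; rewrite gp /=.
  apply/forall_inP=> q; rewrite !inE => /orP[/eqP->|/cp //].
  have [n1 n2] := nab _ pF.
  by rewrite /compat /= (nx _ pF) n1 n2 orbT.
(* Induction on [S], removing a vertex [w] with at most 5 contracted neighbours. An [x] that this
   brings down to two neighbours has both of them among these 5, by [satur]; 5 * 5 pairs with at
   most 2 vertices each give 50, and [X0] adds 6 per vertex of [W]. *)
suff claim (S : {set V}) : S \subset W ->
    #|[set x in X :\: X0 | 2 < #|nbrs g S x|]| <= 50 * #|S|.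
  have := claim _ (subxx W).
  rewrite (_ : [set x in X :\: X0 | _] = X :\: X0); last first.
    apply/setP=> x; rewrite inE; case: (boolP (x \in X :\: X0)) => //=.
    by rewrite inE => /andP[_ /deg3].
  have := cardsID X0 X; have := subset_leq_card (subsetIr X X0); lia.
have [n] := ubnP #|S|; elim: n => // n IH in S *; rewrite ltnS => leS sW.
have [->|neS] := eqVneq S set0.
  rewrite (_ : [set x in _ | _] = set0) ?cards0 //.
  by apply/setP=> x; rewrite !inE (_ : nbrs g set0 x = set0) ?cards0 ?andbF //; apply/setP=> z; rewrite !inE.
have posS : 0 < #|S| by rewrite card_gt0.
have [w wS degw] : exists2 w, w \in S & #|nbrs H S w| < 6.
  by apply: exists_low_degree; have := sparse _ sW; lia.
have cS := cardsD1 w S; rewrite wS in cS.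
have lt1 : #|S :\ w| < n by lia.
have IHw := IH _ lt1 (subset_trans (subD1set _ _) sW).
pose N := nbrs H S w.
pose N2 := [set p : V * V | (p.1 \in N) && (p.2 \in N)].
pose Y (p : V * V) := if uniq [:: w; p.1; p.2] then [set x | [&& g x w, g x p.1 & g x p.2]] else set0.
have le2 : #|\bigcup_(p in N2) Y p| <= #|N2| * 2.
  by apply: card_bigcup_leq => p _; rewrite /Y; case: ifP => [/K33f//|]; rewrite cards0.
have leN2 : #|N2| <= #|N| * #|N| by exact: (@card_dep_pairs_leq _ _ N (fun _ => N)).
have le25 : #|N| * #|N| <= 5 * 5 by apply: leq_mul.
suff sub : [set x in X :\: X0 | 2 < #|nbrs g S x|] \subset
    [set x in X :\: X0 | 2 < #|nbrs g (S :\ w) x|] :|: \bigcup_(p in N2) Y p.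
  have := leq_trans (subset_leq_card sub) (leq_card_setU _ _); lia.
apply/subsetP=> x; rewrite in_setU inE => /andP[xX ds].
rewrite inE xX /=; case: ltnP => //= le.
have := nbrsD1 g S x w; case: (boolP (w \in nbrs g S x)) => [wx e|_ e]; last by lia.
have /card_gt1P[b [c [bS cS' bNc]]] : 1 < #|nbrs g (S :\ w) x| by lia.
move: bS cS' wx; rewrite !inE => /andP[/andP[bw bS] gxb] /andP[/andP[cw cS'] gxc] /andP[_ gxw].
have inWx z : z \in S -> g x z -> z \in nbrs g W x.
  by move=> zS gxz; rewrite inE gxz (subsetP sW).
apply/bigcupP; exists (b, c).
  by rewrite !inE /= bS cS' /= !(satur x) ?inWx // eq_sym.
by rewrite /Y /= !inE negb_or !(eq_sym w) bw cw bNc /= inE gxw gxb gxc.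
Qed.

End Triples.

(** * Triangles with a vertex of small degree *)

Section Dense.
Variables (V : finType) (g : rel V).
Hypotheses (symg : symmetric g) (irrg : irreflexive g) (K5f : K5_free g) (K33f : K33_free g).

Let N (x : V) : {set V} := nbrs g [set: V] x.

Lemma in_N x y : (y \in N x) = g x y. Proof. by rewrite !inE. Qed.

Section Matching.
Variable J : {set V * V}.

Definition within1 (u v : V) := (u == v) || g u v.
Definition touch (p q : V * V) :=
  [|| within1 p.1 q.1, within1 p.1 q.2, within1 p.2 q.1 | within1 p.2 q.2].

Lemma within1_sym u v : within1 u v = within1 v u. Proof. by rewrite /within1 eq_sym symg. Qed.

Definition induced_matching :=
  [forall p in J, g p.1 p.2 && [forall q in J, touch p q ==> (p == q)]].

Hypotheses (indJ : induced_matching)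
  (noT : forall p z, p \in J -> ~~ (g p.1 z && g p.2 z)).

(* Contracting an edge that lies in no triangle loses just that edge. *)
Lemma induced_matching_bound s : 6 * #|V| <= #|arcs g [set: V]| + 2 * s -> 2 * #|J| <= s.
Proof.
move=> dense; move/forall_inP: indJ => iJ.
have gJ p : p \in J -> g p.1 p.2 by move=> /iJ /andP[].
have tJ p q : p \in J -> q \in J -> touch p q -> p = q.
  by move=> /iJ /andP[_ /forall_inP h] /h /implyP h' /h' /eqP.
have tJ12 p q : p \in J -> q \in J -> p.1 != q.2.
  move=> pJ qJ; apply/eqP=> e; have epq : p = q by apply: tJ; rewrite // /touch /within1 e eqxx !orbT.
  by have := gJ _ pJ; rewrite e epq irrg.
(* [pi] contracts each edge of [J] onto its first end; only one orientation of an edge can be in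
   [J], since the two orientations touch. *)
pose pi v := if [pick p in J | p.2 == v] is Some p then p.1 else v.
have piP v : (pi v = v /\ forall p, p \in J -> p.2 != v) \/ (exists2 p, p \in J & p.2 = v /\ pi v = p.1).
  rewrite /pi; case: pickP => [p /andP[pJ /eqP e]|h]; first by right; exists p.
  by left; split=> // p pJ; have := h p; rewrite pJ /= => ->.
pose S := ~: [set p.2 | p in J].
have cS : #|S| = #|V| - #|J|.
  rewrite cardsCs setCK card_in_imset // => p q pJ qJ e.
  by apply: tJ; rewrite // /touch /within1 e eqxx !orbT.
have leJ : #|J| <= #|V|.
  rewrite -(card_in_imset (f := snd) (D := J)) ?max_card // => p q pJ qJ e.
  by apply: tJ; rewrite // /touch /within1 e eqxx !orbT.
have piS v : pi v \in S.
  rewrite inE; apply/imsetP=> -[q qJ e]; case: (piP v) => [[ev h]|[p pJ [_ ev]]].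
    by have := h _ qJ; rewrite -e ev eqxx.
  by have := tJ12 _ _ pJ qJ; rewrite -ev e eqxx.
have pi_id x : x \in S -> pi x = x.
  rewrite inE => xS; case: (piP x) => [[]//|[p pJ [e _]]].
  by case/negP: xS; rewrite -e; apply/imsetP; exists p.
pose B x := [set v | pi v == x].
pose H : rel V := fun x y => (x != y) && [exists u, [exists v, [&& pi u == x, pi v == y & g u v]]].
have HP x y : reflect (x != y /\ exists u v, [/\ pi u = x, pi v = y & g u v]) (H x y).
  apply: (iffP andP) => -[ne].
    by move=> /existsP[u /existsP[v /and3P[/eqP e1 /eqP e2 guv]]]; split=> //; exists u, v.
  move=> [u [v [e1 e2 guv]]]; split=> //; apply/existsP; exists u; apply/existsP; exists v.
  by rewrite e1 e2 guv !eqxx.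
have symH : symmetric H.
  by move=> x y; apply/HP/HP => -[ne [u [v [e1 e2 guv]]]]; split; rewrite 1?eq_sym //; exists v, u; rewrite symg.
have irrH : irreflexive H by move=> x; rewrite /H eqxx.
have mB : minor g H S B.
  split.
  - move=> x xS; rewrite (_ : B x = x |: [set v in B x | v != x]); last first.
      apply/setP=> v; rewrite !inE; case: (eqVneq v x) => [->|_]; rewrite ?andbT ?andbF //=.
      by rewrite pi_id ?eqxx.
    apply: conn_star => // v; rewrite !inE => /andP[/eqP e ne].
    case: (piP v) => [[e' _]|[p pJ [e1 e2]]]; first by rewrite -e e' eqxx in ne.
    by rewrite -e e2 -e1 gJ.
  - by move=> x y z _ _; rewrite !inE => /eqP -> /eqP.
  - by move=> x y _ _ /HP[_ [u [v [e1 e2 guv]]]]; exists u, v; rewrite !inE e1 e2 !eqxx.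
have bnd := edge_bound symg K5f symH irrH mB.
pose JJ := J :|: [set (p.2, p.1) | p in J].
have JJP u v : (u, v) \in JJ -> (u, v) \in J \/ (v, u) \in J.
  by rewrite inE => /orP[|/imsetP[[a b] pJ [-> ->]]]; [left | right].
have JJs u v : (u, v) \in J -> (u, v) \in JJ /\ (v, u) \in JJ.
  by move=> h; split; rewrite inE; [rewrite h | apply/orP; right; apply/imsetP; exists (u, v)].
have pieq u v : pi u = pi v -> u = v \/ (u, v) \in JJ.
  case: (piP u) => [[eu _]|[[p1 p2] pJ [/= eu1 eu2]]]; case: (piP v) => [[ev _]|[[q1 q2] qJ [/= ev1 ev2]]] e.
  - by left; rewrite -eu -ev.
  - by right; rewrite -eu e ev2 -ev1; case: (JJs _ _ qJ).
  - by right; rewrite -ev -e eu2 -eu1; case: (JJs _ _ pJ).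
  - have pq : (p1, p2) = (q1, q2) by apply: tJ; rewrite // /touch /within1 /= -eu2 -ev2 e eqxx.
    by left; rewrite -eu1 -ev1; case: pq.
(* Two arcs with the same image differ at an end by an edge of [J]. If they differ at one end only,
   the other end closes a triangle on that edge. If at both, the two edges touch through the arc,
   hence coincide, and the arc is a loop or lies in [JJ]. *)
have le1 : #|arcs g setT :\: JJ| <= #|arcs H S|.
  rewrite -(card_in_imset (f := fun p => (pi p.1, pi p.2)) (D := arcs g setT :\: JJ)).
    apply/subset_leq_card/subsetP=> _ /imsetP[[u v] uv ->]; rewrite !inE /= in uv.
    rewrite inE /= !piS /=; apply/HP; case/andP: uv => nJJ guv; split; last by exists u, v.
    apply/eqP=> /pieq[e|]; first by rewrite e irrg in guv.
    by rewrite inE (negbTE nJJ).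
  move=> [u v] [u' v']; rewrite inE [in X in _ -> X]inE !inE /=.
  move=> /andP[n1 g1] /andP[n2 g2] [/pieq eu /pieq ev].
  have nuv : ~ ((u, v) \in JJ) by apply/negP; rewrite inE.
  have nuv' : ~ ((u', v') \in JJ) by apply/negP; rewrite inE.
  have noT' a b z : (a, b) \in JJ -> g a z -> g b z -> False.
    move=> /JJP[] abJ ga gb; have := noT z abJ; by rewrite /= ga gb.
  case: eu => [eu|eu]; case: ev => [ev|ev]; first by rewrite eu ev.
  - by case: (noT' _ _ u ev); rewrite symg // eu.
  - by case: (noT' _ _ v eu); rewrite // ev.
  - exfalso.
    have key a b c d : (a, b) \in J -> (c, d) \in J ->
        [|| within1 a c, within1 a d, within1 b c | within1 b d] -> (a, b) = (c, d).
      by move=> h1 h2 h3; exact: tJ.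
    have nuv1 : within1 u v by rewrite /within1 g1 orbT.
    have nvu1 : within1 v u by rewrite within1_sym.
    case/JJP: eu => eu; case/JJP: ev => ev.
    + have [e1 e2] : (u, u') = (v, v') by apply: key; rewrite ?nuv1.
      by rewrite e1 irrg in g1.
    + have [e1 e2] : (u, u') = (v', v) by apply: key; rewrite ?nuv1 ?orbT.
      by rewrite -e2 in nuv; case: nuv; case: (JJs _ _ eu).
    + have [e1 e2] : (u', u) = (v, v') by apply: key; rewrite ?nuv1 ?orbT.
      by rewrite -e1 in nuv; case: nuv; case: (JJs _ _ eu).
    + have [e1 e2] : (u', u) = (v', v) by apply: key; rewrite ?nuv1 ?orbT.
      by rewrite e2 irrg in g1.
have le2 : #|JJ| <= 2 * #|J|.
  apply: leq_trans (leq_card_setU _ _) _; rewrite mul2n -addnn leq_add2l.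
  exact: leq_imset_card.
(* Each contraction lowers the bound by 6 but loses only 2 arcs, those in [JJ]; so [4 * #|J|] fits
   into the slack [2 * s]. *)
have := cardsID JJ (arcs g setT); have := subset_leq_card (subsetIr (arcs g setT) JJ).
lia.
Qed.

End Matching.

Variables (s L : nat).
Hypothesis dense : 6 * #|V| <= #|arcs g [set: V]| + 2 * s.

Definition low (x : V) := #|nbrs g [set: V] x| < L.

Lemma card_within1 u : low u -> #|[set v | within1 u v]| <= L.
Proof.
move=> lu; rewrite (_ : [set v | within1 u v] = u |: N u); last first.
  by apply/setP=> v; rewrite !inE /within1 eq_sym.
by rewrite cardsU1; apply: leq_trans lu; rewrite -add1n leq_add2r; case: (_ \notin _).
Qed.

Definition low_isolated : {set V * V} :=
  [set p | [&& g p.1 p.2, low p.1, low p.2 & [forall z, ~~ (g p.1 z && g p.2 z)]]].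

Lemma card_swap (A : {set V * V}) : #|[set p | (p.2, p.1) \in A]| = #|A|.
Proof.
rewrite -(card_imset (f := fun p : V * V => (p.2, p.1))).
  by congr #|pred_of_set _|; apply/setP=> -[a b]; apply/imsetP/idP => [[[c d]] + [-> ->]|h];
     [rewrite inE | exists (b, a); rewrite ?inE].
by move=> [a b] [c d] [-> ->].
Qed.

(** Take a maximal induced matching [J] inside [low_isolated]. Every member touches an edge of [J];
    as all degrees involved are below [L], each edge of [J] is touched by at most [4 * (L * L)]
    members, and [#|J|] is at most half of [s]. *)
Lemma low_isolated_bound : #|low_isolated| <= 2 * (L * L) * s.
Proof.
pose P J := induced_matching J && (J \subset low_isolated).
have P0 : P set0 by rewrite /P sub0set andbT; apply/forall_inP=> p; rewrite inE.
have [J /maxsetP[/andP[indJ subJ] maxJ] _] := maxset_exists P0.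
have noT p z : p \in J -> ~~ (g p.1 z && g p.2 z).
  by move=> /(subsetP subJ); rewrite inE => /and4P[_ _ _ /forallP].
have leJ := induced_matching_bound indJ noT dense.
suff : #|low_isolated| <= #|J| * (4 * (L * L)) by move: leJ; clear; nia.
pose Y (u : V) := [set q : V * V | (q.1 \in [set v | within1 u v & low v]) && (q.2 \in N q.1)].
have cY u : low u -> #|Y u| <= L * L.
  move=> lu; apply: leq_trans (_ : #|[set v | within1 u v & low v]| * L <= _).
    apply: card_dep_pairs_leq => v; rewrite inE => /andP[_]; exact: ltnW.
  rewrite leq_mul2r; apply/orP; right; apply: leq_trans (card_within1 lu).
  by apply/subset_leq_card/subsetP=> v; rewrite !inE => /andP[].
pose Z (p : V * V) := (Y p.1 :|: [set q | (q.2, q.1) \in Y p.1])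
                  :|: (Y p.2 :|: [set q | (q.2, q.1) \in Y p.2]).
apply: (@leq_trans #|\bigcup_(p in J) Z p|); last first.
  apply: card_bigcup_leq => p /(subsetP subJ); rewrite inE => /and4P[_ l1 l2 _].
  have cY2 u : low u -> #|Y u :|: [set q | (q.2, q.1) \in Y u]| <= 2 * (L * L).
    move=> lu; apply: leq_trans (leq_card_setU _ _) _.
    by rewrite card_swap mul2n -addnn leq_add ?cY.
  apply: leq_trans (leq_card_setU _ _) _.
  by rewrite (_ : 4 = 2 + 2) // mulnDl leq_add ?cY2.
apply/subset_leq_card/subsetP=> q qI.
have := qI; rewrite inE => /and4P[gq l1 l2 _].
suff [p pJ tpq] : exists2 p, p \in J & touch p q.
  apply/bigcupP; exists p => //; move: tpq; rewrite !inE /touch l1 l2 gq symg gq /= !andbT.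
  by case/or4P=> ->; rewrite ?orbT.
case: (boolP [exists p in J, touch p q]) => [/exists_inP//|/exists_inPn far]; exfalso.
have tqq : touch q q by rewrite /touch /within1 eqxx.
have qJ : q \notin J by apply: contraL tqq; exact: far.
suff Pq : P (q |: J).
  by have /setP/(_ q) := maxJ _ Pq (subsetUr _ _); rewrite !inE eqxx (negbTE qJ).
have symt p p' : touch p p' = touch p' p.
  by rewrite /touch !(within1_sym _ p'.1) !(within1_sym _ p'.2); congr (_ || _); rewrite orbCA.
rewrite /P subUset sub1set qI subJ !andbT.
apply/forall_inP=> p; rewrite !inE => /orP[/eqP->|pJ].
  rewrite gq /=; apply/forall_inP=> p'; rewrite !inE => /orP[/eqP->|/far]; first by rewrite eqxx implybT.
  by rewrite symt => /negbTE->.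
move/forall_inP/(_ p pJ)/andP: indJ => [-> /forall_inP h] /=.
by apply/forall_inP=> p'; rewrite !inE => /orP[/eqP->|/h //]; rewrite (negbTE (far _ pJ)).
Qed.

(* If [p] is deleted, then [y] still records its two ends. *)
Definition good_arcs : {set V * V} :=
  [set p | g p.1 p.2 && [exists y, [&& low y, g p.1 y & g y p.2]]].

(** Deleting these vertices costs at most 4 arcs each, while the sparsity bound drops by 6 each; the
    difference must fit into the slack [2 * s]. *)
Lemma few_small_degree : #|[set x | #|N x| <= 2]| <= s.
Proof.
set U := [set x | _].
pose A := [set p : V * V | (p.1 \in U) && (p.2 \in N p.1)].
have leA : #|A| <= #|U| * 2 by apply: card_dep_pairs_leq => x; rewrite inE.
have := K5_free_sparse symg irrg K5f (~: U); have := cardsC U.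
suff : #|arcs g setT| <= #|arcs g (~: U)| + (#|A| + #|A|) by lia.
rewrite -{2}(card_swap A).
apply: leq_trans (_ : #|arcs g (~: U) :|: (A :|: [set p | (p.2, p.1) \in A])| <= _); last first.
  by apply: leq_trans (leq_card_setU _ _) _; rewrite leq_add2l leq_card_setU.
apply/subset_leq_card/subsetP=> -[x y]; rewrite !in_setU !inE /= => gxy.
by rewrite (symg y) gxy !andbT; case: (_ <= 2); case: (_ <= 2).
Qed.

(** [W] is small by summing degrees. A vertex outside [W], outside [X] and of degree at least 3
    keeps a low neighbour, which gives many arcs between low vertices. Such an arc [(x, y)], unless
    in [low_isolated], lies in a triangle with some [z] and is charged to the good arc [(x, z)],
    which receives fewer than [L] charges because [x] is low. *)
Lemma good_arcs_bound (W := [set x | ~~ low x]) :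
  L * #|W| <= 6 * #|V| /\
  #|V| <= L * #|good_arcs| + 57 * #|W| + s + 2 * (L * L) * s.
Proof.
split.
  have := K5_free_sparse symg irrg K5f setT; rewrite cardsT card_arcs.
  suff : L * #|W| <= \sum_(x in [set: V]) #|nbrs g setT x| by lia.
  rewrite mulnC -sum_nat_const [X in _ <= X](bigID (mem W)) /=.
  apply: leq_trans (leq_addr _ _).
  rewrite [X in _ <= X](eq_bigl (mem W)); last by move=> x; rewrite inE.
  by apply: leq_sum => x; rewrite inE -leqNgt.
pose X := [set x | low x && (2 < #|nbrs g W x|)].
have leX : #|X| <= 56 * #|W|.
  apply: (triple_bound symg K5f K33f) => x; rewrite !inE => /andP[] //.
  by move=> ->.
pose LL := [set p : V * V | [&& g p.1 p.2, low p.1 & low p.2]].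
have cover : [set: V] \subset (W :|: X) :|: ([set x | #|N x| <= 2] :|: fst @: LL).
  apply/subsetP=> x _; rewrite !in_setU.
  case: (boolP (x \in W)) => //= xW.
  have lx : low x by move: xW; rewrite inE negbK.
  case: (boolP (x \in X)) => //= xX.
  have leW : #|nbrs g W x| <= 2 by move: xX; rewrite inE lx /= -leqNgt.
  rewrite inE; case: leqP => //= ltN.
  have : ~~ (N x \subset nbrs g W x).
    by apply: contraTN ltN => /subset_leq_card le; rewrite -leqNgt (leq_trans le).
  move=> /subsetPn[y]; rewrite !inE /= => gxy; rewrite gxy andbT negbK => ly.
  by apply/imsetP; exists (x, y); rewrite ?inE /= ?gxy ?lx.
have le1 : #|V| <= #|W| + #|X| + (s + #|LL|).
  rewrite -cardsT; apply: leq_trans (subset_leq_card cover) _.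
  apply: leq_trans (leq_card_setU _ _) _; apply: leq_add; first exact: leq_card_setU.
  apply: leq_trans (leq_card_setU _ _) _; apply: leq_add; first exact: few_small_degree.
  exact: leq_imset_card.
pose F (p : V * V) := if low p.1 then [set q : V * V | (q.1 \in [set p.1]) && (q.2 \in N q.1)] else set0.
have leF : #|\bigcup_(p in good_arcs) F p| <= #|good_arcs| * L.
  apply: card_bigcup_leq => p _; rewrite /F; case: ifP => [lp|]; last by rewrite cards0.
  apply: leq_trans (_ : #|[set p.1]| * L <= _); last by rewrite cards1 mul1n.
  by apply: card_dep_pairs_leq => x; rewrite inE => /eqP->; exact: ltnW.
have le2 : #|LL| <= #|low_isolated| + #|good_arcs| * L.
  apply: leq_trans (_ : #|low_isolated :|: \bigcup_(p in good_arcs) F p| <= _); last first.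
    by apply: leq_trans (leq_card_setU _ _) _; rewrite leq_add2l.
  apply/subset_leq_card/subsetP=> -[x y]; rewrite inE /= => /and3P[gxy lx ly].
  rewrite in_setU; case: (boolP (_ \in low_isolated)) => //=.
  rewrite inE /= gxy lx ly /= => /forallPn[z]; rewrite negbK => /andP[gxz gyz].
  apply/bigcupP; exists (x, z); last by rewrite /F lx inE /= set11 in_N.
  by rewrite inE /= gxz; apply/existsP; exists y; rewrite ly gxy.
have := low_isolated_bound; lia.
Qed.

End Dense.

(** The threshold 684 is 2 * 6 * 57, so that [57 * #|W|] is at most half of [#|V|]. Doubling what
    remains gives 1368 = 2 * 684, and 2000 * 1000 exceeds 2 * (1 + 2 * 684 * 684). *)
Lemma many_good_arcs (V : finType) (g : rel V) s :
    symmetric g -> irreflexive g -> K5_free g -> K33_free g ->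
    6 * #|V| <= #|arcs g [set: V]| + 2 * s ->
  #|V| <= 1368 * #|good_arcs g 684| + 2000 * 1000 * s.
Proof.
move=> symg irrg K5f K33f dense.
have [] := good_arcs_bound symg irrg K5f K33f 684 dense.
set w := #|_ : {set V}|; set a := #|good_arcs _ _|; move: #|V| w a => v w a; clear.
lia.
Qed.

(** * Double counting *)

Lemma adj_sym n (E : {set {set 'I_n}}) : symmetric (adj E).
Proof. by move=> u v; rewrite /adj setUC. Qed.

Lemma adj_irr n (E : {set {set 'I_n}}) : simple_graph E -> irreflexive (adj E).
Proof. by move=> simE u; apply/negP => /(forall_inP simE); rewrite setUid cards1. Qed.

Lemma card_arcs_adj n (E : {set {set 'I_n}}) : simple_graph E ->
  #|arcs (adj E) [set: 'I_n]| = 2 * #|E|.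
Proof.
move=> simE; rewrite -sum1_card.
rewrite (partition_big (fun p => [set p.1; p.2]) (mem E)) /=; last first.
  by move=> p; rewrite !inE /= => pE.
rewrite mulnC -sum_nat_const; apply: eq_bigr => e eE.
have /cards2P[u [v [uv ee]]] := forall_inP simE _ eE.
rewrite sum1_card -[RHS](_ : #|[set (u, v); (v, u)]| = 2); last first.
  by rewrite cards2 xpair_eqE negb_and uv.
rewrite -[LHS]cardsE; congr #|pred_of_set _|; apply/setP=> -[x y]; rewrite inE unfold_in !inE /= !xpair_eqE.
apply/andP/orP => [[_ /eqP exy]|xy].
  have xe : x \in e by rewrite -exy !inE eqxx.
  have ye : y \in e by rewrite -exy !inE eqxx orbT.
  have ue : u \in [set x; y] by rewrite exy ee !inE eqxx.
  have ve : v \in [set x; y] by rewrite exy ee !inE eqxx orbT.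
  move: (And4 xe ye ue ve); rewrite ee !inE => -[/orP[]/eqP-> /orP[]/eqP->]; rewrite ?eqxx ?orbb => e1 e2; auto.
    by rewrite eq_sym e2 in uv.
  by rewrite e1 in uv.
have exy : [set x; y] = e.
  by rewrite ee; case: xy => /andP[/eqP-> /eqP->] //; rewrite setUC.
by rewrite exy /adj exy.
Qed.

Section DoubleCounting.
Variables (n m s : nat) (P : {set {set {set 'I_n}}}).
Hypotheses (simP : forall E, E \in P -> simple_graph E)
  (cardP : forall E, E \in P -> #|E| = m)
  (K5P : forall E, E \in P -> K5_free (adj E))
  (K33P : forall E, E \in P -> K33_free (adj E))
  (swapP : forall E e a b, E \in P -> e \in E -> ~~ connect (adj E) a b ->
     [set a; b] |: (E :\ e) \in P)
  (ms : m + s = 3 * n) (n_large : 4000 * 1000 * s <= n) (n_pos : 0 < n).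

Let D := [set E in P | ~~ connected_graph E].
Let good (E : {set {set 'I_n}}) := good_arcs (adj E) 684.
Let split (E : {set {set 'I_n}}) := [set p : 'I_n * 'I_n | ~~ connect (adj E) p.1 p.2].
(* Contains every arc that may have been deleted to obtain [E]. *)
Let candidates (E : {set {set 'I_n}}) :=
  \bigcup_(y in [set y | #|nbrs (adj E) setT y| <= 684])
     [set p : 'I_n * 'I_n | (p.1 \in nbrs (adj E) setT y) && (p.2 \in nbrs (adj E) setT y)].

(** By [n_large] the error term is at most half of [n], which doubles 1368. *)
Lemma many_good E : E \in P -> n <= 2736 * #|good E|.
Proof.
move=> EP; have := many_good_arcs (s := s) (@adj_sym _ E) (adj_irr (simP EP)) (K5P EP) (K33P EP).
rewrite card_arcs_adj ?simP // cardP // card_ord -/(good E).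
by move: #|good E| => c; lia.
Qed.

(** Let [u] and [v] be separated. No [w] is connected to both, so [w] forms a split pair with one of
    them; the second component [w] makes these [n] pairs distinct. *)
Lemma many_split E : E \in D -> n <= #|split E|.
Proof.
rewrite inE => /andP[EP /forallPn[u /forallPn[v nuv]]].
pose f w := if connect (adj E) u w then (v, w) else (u, w).
rewrite -[n in n <= _]card_ord -cardsT -(card_imset (f := f)); last first.
  by move=> x y; rewrite /f; case: ifP => _; case: ifP => _ [].
apply/subset_leq_card/subsetP => _ /imsetP[w _ ->]; rewrite inE /f; case: ifP => [uw|/= ->] //.
apply: contra nuv => /= vw; apply: connect_trans uw _.
by rewrite (sym_connect_sym (@adj_sym _ E)).
Qed.

Lemma few_candidates E : #|candidates E| <= n * (684 * 684).
Proof.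
apply: leq_trans (_ : #|[set y | #|nbrs (adj E) setT y| <= 684]| * (684 * 684) <= _).
  apply: card_bigcup_leq => y; rewrite inE => le.
  apply: leq_trans (card_dep_pairs_leq (F := fun _ => nbrs (adj E) setT y) (k := 684) _) _ => //.
  by rewrite leq_mul2r le orbT.
by rewrite leq_mul2r -[X in _ <= X]card_ord max_card orbT.
Qed.

Lemma few_bridges E : E \in P -> #|bridges (adj E) setT| <= s.
Proof.
move=> EP.
have := bridges_bound (@adj_sym _ E) (adj_irr (simP EP)) (S := setT).
move=> /(_ (fun S' _ => K5_free_sparse (@adj_sym _ E) (adj_irr (simP EP)) (K5P EP) S')).
by rewrite card_arcs_adj ?simP // cardP // cardsT card_ord; lia.
Qed.

(** Both ordered pairs are carried along so that [E] can be recovered; they are swapped because the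
    inserted pair becomes the bridge and the deleted one the candidate. *)
Definition exchange (x : {set {set 'I_n}} * (('I_n * 'I_n) * ('I_n * 'I_n))) :=
  let: (E, (f, ab)) := x in
  ([set ab.1; ab.2] |: (E :\ [set f.1; f.2]), (ab, f)).

Lemma disconnected_bound : #|D| * n <= #|P| * (s * (2736 * (684 * 684))).
Proof.
pose dom := [set x : {set {set 'I_n}} * (('I_n * 'I_n) * ('I_n * 'I_n)) |
   (x.1 \in D) && (x.2 \in setX (good x.1) (split x.1))].
pose cod := [set x : {set {set 'I_n}} * (('I_n * 'I_n) * ('I_n * 'I_n)) |
   (x.1 \in P) && (x.2 \in setX (bridges (adj x.1) setT) (candidates x.1))].
have le_cod : #|cod| <= #|P| * (s * (n * (684 * 684))).
  apply: (@card_dep_pairs_leq _ _ P (fun E => setX (bridges (adj E) setT) (candidates E))) => E EP.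
  by rewrite cardsX leq_mul ?few_bridges ?few_candidates.
have ge_dom : #|D| * (n * n) <= 2736 * #|dom|.
  rewrite (card_dep_pairs D (fun E => setX (good E) (split E))) big_distrr -sum_nat_const /=.
  apply: leq_sum => E ED; have EP : E \in P by move: ED; rewrite inE => /andP[].
  by rewrite cardsX mulnA leq_mul ?many_good ?many_split.
have domP E f ab : (E, (f, ab)) \in dom -> [/\ E \in P, [set f.1; f.2] \in E,
    [set ab.1; ab.2] \notin E, ~~ connect (adj E) ab.1 ab.2 &
    exists y, [/\ low (adj E) 684 y, adj E f.1 y & adj E y f.2]].
  rewrite !inE /= => /andP[/andP[EP _] /andP[/andP[fE /existsP[y /and3P[ly fy yf]]] nab]].
  split=> //; last by exists y.
  by apply: contra nab => abE; exact: connect1.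
have le_dc : #|dom| <= #|cod|.
  rewrite -(card_in_imset (f := exchange) (D := dom)).
    apply/subset_leq_card/subsetP => _ /imsetP[[E [f ab]] /domP[EP fE abE nab [y [ly fy yf]]] ->].
    rewrite /exchange inE in_setX /=.
    set E' := [set ab.1; ab.2] |: (E :\ [set f.1; f.2]).
    have E'P : E' \in P by exact: swapP.
    have irrE := adj_irr (simP EP).
    rewrite E'P /=; apply/andP; split.
      rewrite inE; apply/andP; split; first by rewrite !inE /= /adj setU11.
      (* A path in the new graph that avoids the inserted edge uses only edges of [E]. *)
      apply: contra nab; apply: connect_sub => u v /and4P[_ _ uv ne]; apply: connect1.
      by move: uv; rewrite /adj in_setU1 (negbTE ne) in_setD1 => /andP[].
    have adjE' u v : adj E u v -> [set u; v] != [set f.1; f.2] -> adj E' u v.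
      by rewrite /adj => uv ne; rewrite in_setU1 in_setD1 ne uv orbT.
    apply/bigcupP; exists y.
      rewrite inE; apply: leq_trans ly.
      (* [y] gains at most one neighbour, the other end of the inserted edge; hence [candidates]
         admits degree 684 although [low] means less than 684. *)
      pose z := if y == ab.1 then ab.2 else ab.1.
      apply: (@leq_trans #|z |: nbrs (adj E) setT y|).
        apply/subset_leq_card/subsetP => w; rewrite !inE /= /adj in_setU1 in_setD1.
        move=> /orP[/eqP yw|/andP[_ ->]]; last by rewrite orbT.
        have : (y \in [set ab.1; ab.2]) && (w \in [set ab.1; ab.2]) by rewrite -yw !inE !eqxx orbT.
        have : (ab.1 \in [set y; w]) && (ab.2 \in [set y; w]) by rewrite yw !inE !eqxx orbT.
        rewrite !inE /z => /andP[h1 h2] /andP[h3 h4].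
        apply/orP; left; case: (eqVneq y ab.1) => [e1|ne].
          case/orP: h4 => [/eqP w1|//].
          by case/orP: h2 => /eqP ->; rewrite ?e1 w1.
        by move: h1; rewrite (eq_sym ab.1) (negbTE ne) /= eq_sym.
      by rewrite cardsU1 -add1n leq_add2r; case: (_ \notin _).
    rewrite !inE /=; apply/andP; split.
      rewrite adj_sym; apply: adjE' => //; apply/eqP => e.
      have : f.2 \in [set f.1; y] by rewrite e !inE eqxx orbT.
      rewrite !inE => /orP[/eqP e2|/eqP e2]; last by rewrite e2 irrE in yf.
      have : y \in [set f.1; f.2] by rewrite -e !inE eqxx orbT.
      by rewrite !inE e2 orbb => /eqP e3; rewrite e3 irrE in fy.
    apply: adjE' => //; apply/eqP => e.
    have : f.1 \in [set y; f.2] by rewrite e !inE eqxx.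
    rewrite !inE => /orP[/eqP e2|/eqP e2]; first by rewrite e2 irrE in fy.
    have : y \in [set f.1; f.2] by rewrite -e !inE eqxx.
    by rewrite !inE e2 orbb => /eqP e3; rewrite e3 irrE in yf.
  move=> [E [f ab]] [E0 [f0 ab0]] /domP[_ fE abE _ _] /domP[_ fE0 abE0 _ _] [eE eab ef].
  rewrite -{}eab -{}ef in fE0 abE0 eE *; congr (_, _).
  rewrite -(setD1K fE) -(setD1K fE0); congr (_ |: _).
  rewrite -(setU1K (B := E :\ _) (a := [set ab.1; ab.2])) ?in_setD1 ?(negbTE abE) ?andbF // eE.
  by rewrite setU1K // in_setD1 (negbTE abE0) andbF.
have : #|D| * (n * n) <= #|P| * (s * (2736 * (684 * 684))) * n.
  apply: leq_trans ge_dom _; apply: (@leq_trans (2736 * #|cod|)).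
    by rewrite leq_mul2l le_dc orbT.
  apply: leq_trans (leq_mul (leqnn 2736) le_cod) _.
  suff -> (a p q r d : nat) : a * (p * (q * (r * d))) = p * (q * (a * d)) * r by [].
  rewrite mulnCA -(mulnA p); congr (_ * _); rewrite mulnCA -(mulnA q).
  by congr (_ * _); rewrite mulnA mulnAC.
by rewrite mulnA leq_pmul2r.
Qed.

End DoubleCounting.

From mathcomp Require Import ring lra.
Import Order.TTheory GRing.Theory Num.Theory.

(** * Winding numbers of chains of points *)

Section Quadrants.
Local Open Scope ring_scope.
Variable R : realDomainType.
Implicit Types (v w : R * R).

(* Half-open quadrants, chosen so that the antipode shifts the code by 2. *)
Definition quadrant v : nat :=
  if (0 < v.1) && (0 <= v.2) then 0
  else if (v.1 <= 0) && (0 < v.2) then 1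
  else if (v.1 < 0) && (v.2 <= 0) then 2 else 3.

(** Opposite codes get 0, as their turn has no definite sign; [adjacent_quadrants] excludes them.
    Adding 4 first keeps the natural subtraction exact for codes below 4. *)
Definition turn (a b : nat) : int :=
  nth 0 [:: 0; 1; 0; -1] ((b + 4 - a) %% 4).

Definition adjacent_quadrants (a b : nat) : bool := ((b + 4 - a) %% 4 != 2)%N.

Definition dist_lt (d : R) v w : bool := (`|v.1 - w.1| < d) && (`|v.2 - w.2| < d).

Definition away (d : R) v : bool := (d <= `|v.1|) || (d <= `|v.2|).

Lemma quadrant_lt4 v : (quadrant v < 4)%N.
Proof. by rewrite /quadrant; do 3?case: ifP. Qed.

Lemma quadrantN v d : 0 < d -> away d v -> quadrant (- v) = ((quadrant v + 2) %% 4)%N.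
Proof.
move=> d0; rewrite /away /quadrant /= !oppr_gt0 !oppr_ge0 !oppr_lt0 !oppr_le0.
case: v => x y /=.
by case: (ltgtP x 0) => hx; case: (ltgtP y 0) => hy //=; rewrite ?hx ?hy normr0 orbb leNgt d0.
Qed.

Lemma dist_lt_adjacent d v w : away d v -> dist_lt d v w ->
  adjacent_quadrants (quadrant v) (quadrant w).
Proof.
case: v w => [a b] [x y]; rewrite /away /dist_lt /quadrant /adjacent_quadrants /=.
rewrite !ltr_norml !ler_normr => hd /andP[/andP[h1 h2] /andP[h3 h4]].
case: (ltgtP a 0) => ha; case: (ltgtP b 0) => hb; case: (ltgtP x 0) => hx;
  case: (ltgtP y 0) => hy //=; exfalso; case/orP: hd => /orP[] hd; lra.
Qed.

Lemma turn_mod a b : (a < 4)%N -> (b < 4)%N -> adjacent_quadrants a b ->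
  exists n : int, turn a b = b%:Z - a%:Z + 4 * n.
Proof.
case: a => [|[|[|[|a]]]] //; case: b => [|[|[|[|b]]]] // _ _ _; rewrite /turn /=.
all: try by exists 0.
all: try by exists 1.
all: by exists (-1).
Qed.

(** Four codes no two of which are opposite occupy at most two consecutive quadrants; there [turn]
    is the difference of a potential, hence independent of the route. *)
Lemma turn_square a b c d : (a < 4)%N -> (b < 4)%N -> (c < 4)%N -> (d < 4)%N ->
    adjacent_quadrants a b -> adjacent_quadrants a c -> adjacent_quadrants a d ->
    adjacent_quadrants b c -> adjacent_quadrants b d -> adjacent_quadrants c d ->
  turn a b + turn b d = turn a c + turn c d.
Proof.
by case: a => [|[|[|[|a]]]] //; case: b => [|[|[|[|b]]]] //;
   case: c => [|[|[|[|c]]]] //; case: d => [|[|[|[|d]]]].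
Qed.

Lemma turn_antipode a b : (a < 4)%N -> (b < 4)%N ->
  turn ((a + 2) %% 4) ((b + 2) %% 4) = turn a b.
Proof. by case: a => [|[|[|[|a]]]] //; case: b => [|[|[|[|b]]]]. Qed.

Lemma dist_lt_le d e v w : d <= e -> dist_lt d v w -> dist_lt e v w.
Proof. by move=> de /andP[h1 h2]; rewrite /dist_lt !(lt_le_trans _ de). Qed.

Lemma dist_ltC d v w : dist_lt d v w = dist_lt d w v.
Proof. by rewrite /dist_lt distrC (distrC v.2). Qed.

Lemma dist_ltBr d v w p : dist_lt d (v - p) (w - p) = dist_lt d v w.
Proof.
rewrite /dist_lt.
have -> : (v - p).1 - (w - p).1 = v.1 - w.1 by rewrite /=; ring.
by have -> : (v - p).2 - (w - p).2 = v.2 - w.2 by rewrite /=; ring.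
Qed.

Lemma dist_ltBl d v w p : dist_lt d (p - v) (p - w) = dist_lt d v w.
Proof.
rewrite [RHS]dist_ltC /dist_lt.
have -> : (p - v).1 - (p - w).1 = w.1 - v.1 by rewrite /=; ring.
by have -> : (p - v).2 - (p - w).2 = w.2 - v.2 by rewrite /=; ring.
Qed.

Lemma dist_ltBB d v v' w w' : dist_lt d v v' -> dist_lt d w w' -> dist_lt (d + d) (v - w) (v' - w').
Proof.
rewrite /dist_lt => /andP[h1 h2] /andP[h3 h4].
have -> : (v - w).1 - (v' - w').1 = (v.1 - v'.1) - (w.1 - w'.1) by rewrite /=; ring.
have -> : (v - w).2 - (v' - w').2 = (v.2 - v'.2) - (w.2 - w'.2) by rewrite /=; ring.
by rewrite !(le_lt_trans (ler_normB _ _)) // ltrD.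
Qed.

Lemma away_le d e v : d <= e -> away e v -> away d v.
Proof. by move=> de /orP[] h; rewrite /away (le_trans de h) ?orbT. Qed.

Lemma awayN d v : away d (- v) = away d v.
Proof. by rewrite /away /= !normrN. Qed.

(* Total change of the quadrant of [x - p] along a sequence of points, counted
   with sign: a discrete winding angle in quarter turns. *)
Fixpoint wind (p x : R * R) (s : seq (R * R)) : int :=
  if s is y :: s' then turn (quadrant (x - p)) (quadrant (y - p)) + wind p y s' else 0.

Variable d : R.
Hypothesis d0 : 0 < d.

Let apart (x y : R * R) := away (d + d) (x - y).

Lemma apart_turn_sym x y y' : apart x y -> apart x y' ->
  turn (quadrant (y - x)) (quadrant (y' - x)) = turn (quadrant (x - y)) (quadrant (x - y')).
Proof.
move=> h h'; rewrite -(opprB x) -(opprB x y').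
have dd : 0 < d + d by rewrite addr_gt0.
by rewrite !(quadrantN dd) // turn_antipode ?quadrant_lt4.
Qed.

(** Each [turn] is the change of code modulo 4, and the changes telescope: up to full turns, the
    winding depends only on the two end directions. *)
Lemma wind_mod p x s : path (dist_lt d) x s -> all (apart^~ p) (x :: s) ->
  exists n : int, wind p x s = (quadrant (last x s - p))%:Z - (quadrant (x - p))%:Z + 4 * n.
Proof.
elim: s x => [|y s IH] x /=; first by exists 0; rewrite subrr addr0.
move=> /andP[xy ps] /andP[ax /= ays]; have [n ->] := IH y ps ays.
have [m ->] : exists m : int, turn (quadrant (x - p)) (quadrant (y - p)) =
    (quadrant (y - p))%:Z - (quadrant (x - p))%:Z + 4 * m.
  apply: turn_mod; rewrite ?quadrant_lt4 //; apply: dist_lt_adjacent ax _.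
  by rewrite dist_ltBr (dist_lt_le _ xy) // lerDl ltW.
by exists (m + n); lia.
Qed.

(** Discrete lifting over the square: around each cell the turns cancel by [turn_square], and the
    cells are summed strip by strip. Where the second chain moves, its directions are reversed,
    which is harmless because antipodes turn alike. *)
Lemma wind_square x s y t : path (dist_lt d) x s -> path (dist_lt d) y t ->
    (forall a b, a \in x :: s -> b \in y :: t -> apart a b) ->
  wind y x s + wind (last x s) y t = wind x y t + wind (last y t) x s.
Proof.
have le_dd : d <= d + d by rewrite lerDl ltW.
have row z z' u r : dist_lt d z z' -> path (dist_lt d) u r ->
    (forall b, b \in u :: r -> apart z b) -> (forall b, b \in u :: r -> apart z' b) ->
    turn (quadrant (z - u)) (quadrant (z' - u)) + wind z' u r =
    wind z u r + turn (quadrant (z - last u r)) (quadrant (z' - last u r)).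
  move=> zz'; elim: r u => [|u' r IH] u /=; first by rewrite addr0 add0r.
  move=> /andP[uu' pr] az az'.
  have iu : u \in [:: u, u' & r] by rewrite mem_head.
  have iu' : u' \in [:: u, u' & r] by rewrite !inE eqxx orbT.
  have sub b : b \in u' :: r -> b \in [:: u, u' & r] by move=> h; rewrite inE h orbT.
  have := IH u' pr (fun b h => az b (sub b h)) (fun b h => az' b (sub b h)).
  rewrite /= (@apart_turn_sym z u u') ?az // (@apart_turn_sym z' u u') ?az' //.
  suff : turn (quadrant (z - u)) (quadrant (z' - u)) + turn (quadrant (z' - u)) (quadrant (z' - u')) =
         turn (quadrant (z - u)) (quadrant (z - u')) + turn (quadrant (z - u')) (quadrant (z' - u')) by lia.
  apply: turn_square; rewrite ?quadrant_lt4 //; (apply: (@dist_lt_adjacent (d + d)); first by first [exact: az | exact: az']).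
  - by rewrite dist_ltBr (dist_lt_le le_dd).
  - by rewrite dist_ltBl (dist_lt_le le_dd).
  - exact: dist_ltBB.
  - by apply: dist_ltBB; rewrite // dist_ltC.
  - by rewrite dist_ltBl (dist_lt_le le_dd).
  - by rewrite dist_ltBr (dist_lt_le le_dd).
elim: s x => [|x' s IH] x /=.
  move=> _ pt ap; rewrite add0r addr0 //.
move=> /andP[xx' ps] pt ap.
have sub b : b \in x' :: s -> b \in [:: x, x' & s] by move=> h; rewrite inE h orbT.
have := IH x' ps pt (fun a b ha hb => ap a b (sub a ha) hb).
have := row x x' y t xx' pt (fun b => ap x b (mem_head _ _)) (fun b => ap x' b (sub _ (mem_head _ _))).
rewrite /=; lia.
Qed.

End Quadrants.

(** * Parity contradiction for K5 and K3,3 *)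

Section Parity.
Local Open Scope ring_scope.

(** In the sum over the 15 independent pairs of edges, each [n i j k] occurs for two choices of the
    other end [l], so its coefficient is even and it contributes a multiple of 8; the antipodal
    differences 2 add up to 4 modulo 8. *)
Lemma K5_parity (th : nat -> nat -> int) (n : nat -> nat -> nat -> int) :
  (forall a b : nat, (a < b)%N -> th a b - th b a = 2) ->
  (forall i j k l : nat, (i < j < 5)%N -> (k < l < 5)%N -> uniq [:: i; j; k; l] ->
     th j k - th i k + 4 * n i j k + (th l j - th k j + 4 * n k l j) =
     th l i - th k i + 4 * n k l i + (th j l - th i l + 4 * n i j l)) -> False.
Proof.
move=> dth Q.
move:
  (Q 0 1 2 3 isT isT isT) (Q 0 1 2 4 isT isT isT) (Q 0 1 3 4 isT isT isT)
  (Q 0 2 1 3 isT isT isT) (Q 0 2 1 4 isT isT isT) (Q 0 2 3 4 isT isT isT)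
  (Q 0 3 1 2 isT isT isT) (Q 0 3 1 4 isT isT isT) (Q 0 3 2 4 isT isT isT)
  (Q 0 4 1 2 isT isT isT) (Q 0 4 1 3 isT isT isT) (Q 0 4 2 3 isT isT isT)
  (Q 1 2 3 4 isT isT isT) (Q 1 3 2 4 isT isT isT) (Q 1 4 2 3 isT isT isT).
do 14 (move=> e1 e2; move: (f_equal2 +%R e1 e2) => {e1 e2}).
move:
  (dth 0 1 isT) (dth 0 2 isT) (dth 0 3 isT) (dth 0 4 isT) (dth 1 2 isT) (dth 1 3 isT)
  (dth 1 4 isT) (dth 2 3 isT) (dth 2 4 isT) (dth 3 4 isT).
clear; lia.
Qed.

(** As for K5, now with 18 pairs: a vertex off the edge [ij] again lies on exactly two edges
    disjoint from [ij]. *)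
Lemma K33_parity (th : nat -> nat -> int) (n : nat -> nat -> nat -> int) :
  (forall a b : nat, (a < b)%N -> th a b - th b a = 2) ->
  (forall i j k l : nat, [&& i < 3, 3 <= j & j < 6]%N -> [&& k < 3, 3 <= l & l < 6]%N -> uniq [:: i; j; k; l] ->
     th j k - th i k + 4 * n i j k + (th l j - th k j + 4 * n k l j) =
     th l i - th k i + 4 * n k l i + (th j l - th i l + 4 * n i j l)) -> False.
Proof.
move=> dth Q.
move:
  (Q 0 3 1 4 isT isT isT) (Q 0 3 1 5 isT isT isT) (Q 0 3 2 4 isT isT isT)
  (Q 0 3 2 5 isT isT isT) (Q 0 4 1 3 isT isT isT) (Q 0 4 1 5 isT isT isT)
  (Q 0 4 2 3 isT isT isT) (Q 0 4 2 5 isT isT isT) (Q 0 5 1 3 isT isT isT)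
  (Q 0 5 1 4 isT isT isT) (Q 0 5 2 3 isT isT isT) (Q 0 5 2 4 isT isT isT)
  (Q 1 3 2 4 isT isT isT) (Q 1 3 2 5 isT isT isT) (Q 1 4 2 3 isT isT isT)
  (Q 1 4 2 5 isT isT isT) (Q 1 5 2 3 isT isT isT) (Q 1 5 2 4 isT isT isT).
do 17 (move=> e1 e2; move: (f_equal2 +%R e1 e2) => {e1 e2}).
move:
  (dth 0 1 isT) (dth 0 2 isT) (dth 0 3 isT) (dth 0 4 isT) (dth 0 5 isT) (dth 1 2 isT)
  (dth 1 3 isT) (dth 1 4 isT) (dth 1 5 isT) (dth 2 3 isT) (dth 2 4 isT) (dth 2 5 isT)
  (dth 3 4 isT) (dth 3 5 isT) (dth 4 5 isT).
clear; lia.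
Qed.

End Parity.

Section Obstructions.
Local Open Scope ring_scope.

Section Obstruction.
Variables (R : realDomainType) (d : R).
Hypothesis d0 : 0 < d.
Variables (P : nat -> R * R) (c : nat -> nat -> seq (R * R)) (E : rel nat).
Hypothesis chain : forall i j, E i j -> path (dist_lt d) (P i) (c i j) /\ last (P i) (c i j) = P j.
Hypothesis apart : forall i j k l, E i j -> E k l -> uniq [:: i; j; k; l] ->
  forall a b, a \in P i :: c i j -> b \in P k :: c k l -> away (d + d) (a - b).

(* Lifting directions to integers makes antipodal directions differ by exactly
   2; the winding numbers [wind] are then determined modulo 4. *)
Lemma parity_data : exists (th : nat -> nat -> int) (n : nat -> nat -> nat -> int),
  (forall a b : nat, (a < b)%N -> th a b - th b a = 2) /\
  (forall i j k l : nat, E i j -> E k l -> uniq [:: i; j; k; l] ->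
     th j k - th i k + 4 * n i j k + (th l j - th k j + 4 * n k l j) =
     th l i - th k i + 4 * n k l i + (th j l - th i l + 4 * n i j l)).
Proof.
pose q a b : int := (quadrant (P a - P b))%:Z.
pose th a b : int := if (a < b)%N then q a b else q b a - 2.
pose A i j k := wind (P k) (P i) (c i j).
(* For independent edges this division is exact, by [wind_mod]. *)
pose n i j k : int := ((A i j k - (th j k - th i k)) %/ 4)%Z.
have dd : 0 < d + d by rewrite addr_gt0.
have thq a b : away (d + d) (P a - P b) -> a != b -> exists m : int, q a b = th a b + 4 * m.
  move=> aw ne; rewrite /th; case: ltnP => _; first by exists 0; rewrite mulr0 addr0.
  rewrite /q -[P a - P b]opprB (quadrantN dd); last by rewrite -awayN opprB.
  have := quadrant_lt4 (P b - P a).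
  by case: (quadrant _) => [|[|[|[|?]]]] // _; [exists 1 | exists 1 | exists 0 | exists 0].
have modA i j k l : E i j -> E k l -> uniq [:: i; j; k; l] ->
    (A i j k = th j k - th i k + 4 * n i j k) /\ (A i j l = th j l - th i l + 4 * n i j l).
  move=> ij kl u; have [p1 l1] := chain ij; have [p2 l2] := chain kl.
  have endi : P i \in P i :: c i j by rewrite mem_head.
  have endj : P j \in P i :: c i j by rewrite -l1 mem_last.
  have endk : P k \in P k :: c k l by rewrite mem_head.
  have endl : P l \in P k :: c k l by rewrite -l2 mem_last.
  have ap := apart ij kl u.
  suff gen z : P z \in P k :: c k l -> i != z -> j != z -> A i j z = th j z - th i z + 4 * n i j z.
    by move: u; rewrite /= !inE !negb_or => /and4P[/and3P[_ ik il] /andP[jk jl] _ _]; split; apply: gen.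
  move=> zin iz jz.
  have [] := @wind_mod R d d0 (P z) (P i) (c i j) p1.
    by apply/allP=> a ain; exact: ap.
  rewrite -/(A i j z) l1 -/(q j z) -/(q i z) => m.
  have [m1 ->] := thq _ _ (ap _ _ endi zin) iz.
  have [m2 ->] := thq _ _ (ap _ _ endj zin) jz => eA.
  have eD : A i j z - (th j z - th i z) = (m2 - m1 + m) * 4 by rewrite eA; ring.
  by rewrite /n eD mulzK // mulrC -eD; ring.
exists th, n; split=> [a b ab|i j k l ij kl u].
  by rewrite /th ab ltnNge (ltnW ab) /=; lia.
have u' : uniq [:: k; l; i; j] by rewrite -(rot_uniq 2).
have [e1 e2] := modA _ _ _ _ ij kl u; have [e3 e4] := modA _ _ _ _ kl ij u'.
have [p1 l1] := chain ij; have [p2 l2] := chain kl.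
have := wind_square d0 p1 p2 (apart ij kl u).
by rewrite l1 l2 -/(A i j k) -/(A k l j) -/(A k l i) -/(A i j l) e1 e2 e3 e4.
Qed.

End Obstruction.

Lemma K5_obstruction (R : realDomainType) (d : R) P c : 0 < d ->
  (forall i j, (i < j < 5)%N -> path (dist_lt d) (P i) (c i j) /\ last (P i) (c i j) = P j) ->
  (forall i j k l, (i < j < 5)%N -> (k < l < 5)%N -> uniq [:: i; j; k; l] ->
     forall a b, a \in P i :: c i j -> b \in P k :: c k l -> away (d + d) (a - b)) -> False.
Proof.
move=> d0 ch ap; have [th [n [dth eqs]]] := parity_data d0 ch ap.
exact: K5_parity dth eqs.
Qed.

Lemma K33_obstruction (R : realDomainType) (d : R) P c : 0 < d ->
  (forall i j, [&& i < 3, 3 <= j & j < 6]%N -> path (dist_lt d) (P i) (c i j) /\ last (P i) (c i j) = P j) ->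
  (forall i j k l, [&& i < 3, 3 <= j & j < 6]%N -> [&& k < 3, 3 <= l & l < 6]%N -> uniq [:: i; j; k; l] ->
     forall a b, a \in P i :: c i j -> b \in P k :: c k l -> away (d + d) (a - b)) -> False.
Proof.
move=> d0 ch ap; have [th [n [dth eqs]]] := parity_data d0 ch ap.
exact: K33_parity dth eqs.
Qed.

End Obstructions.

From mathcomp Require Import all_classical all_reals all_analysis.
Import Order.TTheory GRing.Theory Num.Theory.
Import numFieldNormedType.Exports.

(** * Planar graphs exclude K5 and K3,3 *)

Section Clamp.
Local Open Scope classical_set_scope.
Local Open Scope ring_scope.
Variable R : realType.

(** Arcs are controlled on [0, 1] only; composing with [clamp] extends them continuously to the line
    without new values. *)
Definition clamp (t : R) : R := Num.max 0 (Num.min t 1).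

Lemma clamp_in t : clamp t \in `[0, 1].
Proof. by rewrite in_itv /clamp /= le_max lexx /= ge_max ler01 ge_min lexx orbT. Qed.

Lemma clamp_id t : t \in `[0, 1] -> clamp t = t.
Proof. by rewrite in_itv /= /clamp => /andP[t0 t1]; rewrite (min_idPl t1) (max_idPr t0). Qed.

Lemma continuous_clamp : continuous clamp.
Proof.
move=> t; apply: (@continuous_max R R (fun=> 0) (fun t => Num.min t 1) t).
  exact: cvg_cst.
by apply: (@continuous_min R R id (fun=> 1) t); [exact: cvg_id | exact: cvg_cst].
Qed.

Lemma continuous_comp_clamp (T : topologicalType) (g : R -> T) :
  {within `[0, 1], continuous g} -> continuous (g \o clamp).
Proof.
move=> /subspace_continuousP cg t U /= Ug.
have := continuous_clamp (cg (clamp t) (clamp_in t) U Ug).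
rewrite /nbhs /=.
by apply: (@filterS _ (nbhs t)) => s /=; apply; exact: clamp_in.
Qed.

Lemma awayE d (v : R * R) : away d v = (d <= `|v|).
Proof. by rewrite prod_normE le_max. Qed.

Lemma dist_ltE d (v w : R * R) : dist_lt d v w = (`|v - w| < d).
Proof. by rewrite prod_normE gt_max. Qed.

Lemma common_positive (I : finType) (P : I -> R -> Prop) :
  (forall i d e, d <= e -> P i e -> P i d) -> (forall i, exists2 d, 0 < d & P i d) ->
  exists2 d, 0 < d & forall i, P i d.
Proof.
move=> mono ex.
have [|f Pf] := @choice I R (fun i d => 0 < d /\ P i d).
  by move=> i; have [d] := ex i; exists d.
exists (\big[Num.min/1]_i f i).
  by elim/big_ind: _ => // [x y x0 y0|i _]; [rewrite lt_min x0 y0 | case: (Pf i)].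
by move=> i; case: (Pf i) => _; apply: mono; exact: bigmin_le.
Qed.

(** The parameters reachable from [a] by such chains form a set that is open and closed, and the
    line is connected. *)
Lemma continuous_chain (g : R -> R * R) d a b : continuous g -> 0 < d ->
  exists s, [/\ path (dist_lt d) (g a) s, last (g a) s = g b &
                forall p, p \in g a :: s -> exists t, p = g t].
Proof.
move=> cg d0.
pose C := [set b | exists s, [/\ path (dist_lt d) (g a) s, last (g a) s = g b &
                forall p, p \in g a :: s -> exists t, p = g t]].
have step t : \forall t' \near t, C t' <-> C t.
  have : \forall t' \near t, `|g t - g t'| < d.
    by have /cvgrPdist_lt := cg t; apply.
  have sub u v : `|g u - g v| < d -> C u -> C v.
    move=> uv [s [ps ls ms]]; exists (rcons s (g v)); split.
    - by rewrite rcons_path ps ls dist_ltE.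
    - by rewrite last_rcons.
    - move=> p; rewrite -rcons_cons mem_rcons inE => /orP[/eqP->|/ms //].
      by exists v.
  by apply: filterS => t' tt'; split; apply: sub => //; rewrite distrC.
have conR : connected (setT : set R) by apply/connected_intervalP => x y _ _ z _.
suff CT : C = setT by have : C b by rewrite CT.
apply: conR.
  - by exists a, [::]; split=> // p; rewrite inE => /eqP->; exists a.
  - exists C; last by rewrite setTI.
    rewrite openE => t Ct; rewrite /interior.
    by have := step t; apply: filterS => t' ->.
  - exists C; last by rewrite setTI.
    rewrite -openC openE => t Ct; rewrite /interior.
    by have := step t; apply: filterS => t' tt' /tt'.
Qed.

Lemma disjoint_paths_away (g h : R -> R * R) : continuous g -> continuous h ->
  (forall s t, s \in `[0, 1] -> t \in `[0, 1] -> g s <> h t) ->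
  exists2 d, 0 < d & forall s t, s \in `[0, 1] -> t \in `[0, 1] -> away d (g s - h t).
Proof.
move=> cg ch dis.
pose f (p : R * R) := `|g p.1 - h p.2|.
have cf : continuous f.
  move=> p; apply: cvg_norm; apply: cvgB.
    by apply: (cvg_comp fst g cvg_fst); exact: cg.
  by apply: (cvg_comp snd h cvg_snd); exact: ch.
have in0 : (0 : R) \in `[0, 1] by rewrite in_itv /= lexx ler01.
have [|||c cin cmin] := @compact_EVT_min _ R f (`[0, 1] `*` `[0, 1])%classic.
- by exists (0, 0); split.
- by apply: compact_setX; exact: segment_compact.
- exact: continuous_subspaceT.
exists (f c).
  rewrite normr_gt0 subr_eq0; apply/eqP.
  by move: cin; rewrite inE => -[/= c1 c2]; exact: dis.
by move=> s t si ti; rewrite awayE; apply: (cmin (s, t)); rewrite inE.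
Qed.

End Clamp.

Section Drawings.
Local Open Scope ring_scope.
Variables (R : realType) (n : nat) (E : {set {set 'I_n}}).
Hypothesis simE : simple_graph E.

Lemma edge_neq0 e : e \in E -> exists v, v \in e.
Proof. by move=> /(forall_inP simE) /eqP e2; apply/set0Pn; rewrite -card_gt0 e2. Qed.

(* [inl v] stands for a vertex and [inr e] for an edge. *)
Definition valid (i : 'I_n + {set 'I_n}) : bool := if i is inr e then e \in E else true.
Definition supp (i : 'I_n + {set 'I_n}) : {set 'I_n} :=
  match i with inl v => [set v]%SET | inr e => e end.
Definition piece (pos : 'I_n -> R * R) (arc : {set 'I_n} -> R -> R * R)
    (i : 'I_n + {set 'I_n}) : R -> R * R :=
  match i with inl v => fun=> pos v | inr e => arc e \o @clamp R end.

Section Drawing.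
Variables (pos : 'I_n -> R * R) (arc : {set 'I_n} -> R -> R * R).
Hypothesis dr : plane_drawing E pos arc.

Lemma arc_end e t : e \in E -> t = 0 \/ t = 1 -> exists2 v, v \in e & arc e t = pos v.
Proof.
case: dr => _ _ ends _ _ eE t01.
have : [set arc e 0; arc e 1]%classic (arc e t) by case: t01 => ->; [left | right].
by rewrite ends // => -[v ve <-]; exists v.
Qed.

Lemma end_arc e v : e \in E -> v \in e -> exists2 t, t \in `[0, 1] & arc e t = pos v.
Proof.
case: dr => _ _ ends _ _ eE ve.
have : (pos @` [set` e])%classic (pos v) by exists v.
rewrite -ends // => -[->|->]; [exists 0 | exists 1] => //;
by rewrite in_itv /= !lexx ler01.
Qed.

Lemma itv01P (t : R) : t \in `[0, 1] -> (t \in `]0, 1[) \/ (t = 0 \/ t = 1).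
Proof.
rewrite !in_itv /= => /andP[]; rewrite !le_eqVlt.
move=> /orP[/eqP <-|t0]; first by right; left.
by move=> /orP[/eqP ->|t1]; [right; right | left; rewrite t0].
Qed.

Lemma arc_vertex e v t : e \in E -> v \notin e -> t \in `[0, 1] -> arc e t <> pos v.
Proof.
case: (dr) => inj _ _ int _ eE ve /itv01P[tin|/(arc_end eE)[u ue ->]]; first exact: int.
by move=> /inj euv; rewrite -euv ue in ve.
Qed.

Lemma arc_disjoint e f s t : e \in E -> f \in E -> [disjoint e & f] ->
  s \in `[0, 1] -> t \in `[0, 1] -> arc e s <> arc f t.
Proof.
case: (dr) => inj _ _ _ int eE fE dis sin tin.
case: (itv01P sin) => [s01|/(arc_end eE)[u ue ->]]; last first.
  by apply/nesym/arc_vertex => //; rewrite (disjointFr dis).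
case: (itv01P tin) => [t01|/(arc_end fE)[v vf ->]]; last first.
  by apply: arc_vertex => //; rewrite (disjointFl dis).
apply: int => // ef; have [v ve] := edge_neq0 eE.
by have := disjointFr dis ve; rewrite -ef ve.
Qed.

(** Pieces with disjoint supports have disjoint compact images, and there are finitely many of them,
    so one distance serves all pairs. *)
Lemma pieces_away : exists2 d, 0 < d & forall i j s t,
  valid i -> valid j -> [disjoint supp i & supp j] -> away d (piece pos arc i s - piece pos arc j t).
Proof.
have cont i : valid i -> continuous (piece pos arc i).
  case: i => [v|e] /=; first by move=> _ t; exact: cvg_cst.
  by case: dr => _ sa _ _ _ /sa[ce _]; exact: continuous_comp_clamp.
have piece_clamp i t : piece pos arc i (clamp t) = piece pos arc i t.
  by case: i => //= e; rewrite clamp_id ?clamp_in.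
pose P (ij : ('I_n + {set 'I_n}) * ('I_n + {set 'I_n})) (d : R) := valid ij.1 -> valid ij.2 ->
  [disjoint supp ij.1 & supp ij.2] ->
  forall s t, s \in `[0, 1] -> t \in `[0, 1] -> away d (piece pos arc ij.1 s - piece pos arc ij.2 t).
have [||d d0 H] := @common_positive R _ P.
- by move=> ij d e de Pe v1 v2 dis s t si ti; apply: away_le de _; exact: Pe.
- move=> [i j]; rewrite /P /=; case: (boolP (valid i)) => vi; last by exists 1.
  case: (boolP (valid j)) => vj; last by exists 1.
  case: (boolP [disjoint supp i & supp j]) => dis; last by exists 1.
  have [d d0 H] : exists2 d, 0 < d &
      forall s t, s \in `[0, 1] -> t \in `[0, 1] -> away d (piece pos arc i s - piece pos arc j t).
    apply: disjoint_paths_away; [exact: cont | exact: cont | move=> s t si ti].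
    case: i j vi vj dis => [v|e] [w|f] /= vi vj dis; rewrite ?clamp_id //.
    + case: dr => inj _ _ _ _ /inj vw.
      by move: (disjointFr dis (set11 v)); rewrite vw set11.
    + by apply/nesym/arc_vertex => //; rewrite (disjointFr dis (set11 v)).
    + by apply: arc_vertex => //; rewrite (disjointFl dis (set11 w)).
    + exact: arc_disjoint.
  by exists d.
exists d => // i j s t vi vj dis.
by rewrite -(piece_clamp i) -(piece_clamp j); apply: (H (i, j)) => //; exact: clamp_in.
Qed.

Lemma conn_chain d (S : {set 'I_n}) u v : 0 < d -> conn (adj E) S -> u \in S -> v \in S ->
  exists s, [/\ path (dist_lt d) (pos u) s, last (pos u) s = pos v &
    forall p, p \in pos u :: s -> exists i, [/\ valid i, supp i \subset S & exists t, p = piece pos arc i t]].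
Proof.
move=> d0 cS uS vS; have /connectP[q pq ->] := cS _ _ uS vS.
elim: q u uS pq => [|w q IH] u uS /=.
  move=> _; exists [::]; split=> // p; rewrite inE => /eqP->.
  by exists (inl u); split; rewrite /= ?finset.sub1set //; exists 0.
move=> /andP[/and3P[_ wS euw] pq]; have [s [ps ls ms]] := IH w wS pq.
have ue : u \in [set u; w]%SET by rewrite !inE eqxx.
have we : w \in [set u; w]%SET by rewrite !inE eqxx orbT.
have [a ain ea] := end_arc euw ue; have [b bin eb] := end_arc euw we.
have ce : continuous (arc [set u; w]%SET \o @clamp R).
  by case: dr => _ sa _ _ _; apply: continuous_comp_clamp; case: (sa _ euw).
have [r [pr lr mr]] := continuous_chain a b ce d0.
rewrite /= !clamp_id // ea eb in pr lr mr.
exists (r ++ s); split.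
- by rewrite cat_path pr lr.
- by rewrite last_cat lr.
move=> p; rewrite -cat_cons mem_cat => /orP[/mr[t ->]|ps'].
  exists (inr [set u; w]%SET); split=> //=; last by exists t.
  by rewrite finset.subUset !finset.sub1set uS.
by apply: ms; rewrite inE ps' orbT.
Qed.

End Drawing.

Definition separated_chains (d : R) (pos : 'I_n -> R * R)
    (c : 'I_n -> 'I_n -> {set 'I_n} -> seq (R * R)) : Prop :=
  (forall u v S, conn (adj E) S -> u \in S -> v \in S ->
     path (dist_lt d) (pos u) (c u v S) /\ last (pos u) (c u v S) = pos v) /\
  (forall u v S u' v' S', conn (adj E) S -> u \in S -> v \in S ->
     conn (adj E) S' -> u' \in S' -> v' \in S' -> [disjoint S & S'] ->
     forall a b, a \in pos u :: c u v S -> b \in pos u' :: c u' v' S' -> away (d + d) (a - b)).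

Lemma planar_chains : planar R E -> exists d pos c, 0 < d /\ separated_chains d pos c.
Proof.
move=> [pos [arc dr]].
have [e e0 He] := pieces_away dr.
(* Half of the separation: steps are shorter than [d], and across a cell both points of a difference
   may move, which calls for the distance [d + d]. *)
pose d := e / 2.
have d0 : 0 < d by rewrite divr_gt0.
have dd : d + d = e by rewrite -splitr.
pose P (x : 'I_n * 'I_n * {set 'I_n}) (s : seq (R * R)) :=
  conn (adj E) x.2 -> x.1.1 \in x.2 -> x.1.2 \in x.2 ->
  [/\ path (dist_lt d) (pos x.1.1) s, last (pos x.1.1) s = pos x.1.2 &
    forall p, p \in pos x.1.1 :: s ->
      exists i, [/\ valid i, supp i \subset x.2 & exists t, p = piece pos arc i t]].
have [|c Hc] := @choice _ _ P.
  move=> [[u v] S]; rewrite /P /=.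
  case: (pselect (conn (adj E) S)) => [cS|]; last by exists [::].
  case: (boolP (u \in S)) => uS; last by exists [::].
  case: (boolP (v \in S)) => vS; last by exists [::].
  by have [s Hs] := conn_chain dr d0 cS uS vS; exists s => _ _ _; exact: Hs.
exists d, pos, (fun u v S => c (u, v, S)); split=> //; split.
  by move=> u v S cS uS vS; have [] := Hc (u, v, S) cS uS vS.
move=> u v S u' v' S' cS uS vS cS' uS' vS' dis a b.
have [_ _ ha] := Hc (u, v, S) cS uS vS; have [_ _ hb] := Hc (u', v', S') cS' uS' vS'.
move=> /ha[i [vi si [s ->]]] /hb[j [vj sj [t ->]]]; rewrite dd.
apply: He => //; apply: disjointWl si _; exact: disjointWr sj _.
Qed.

(** Fix a representative [r i] in each branch set and trace the edge [ij] by a chain inside the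
    union of its two branch sets. For independent pairs these unions are disjoint, so the chains
    stay apart. *)
Lemma planar_K5_free : planar R E -> K5_free (adj E).
Proof.
move=> /planar_chains[d [pos [c [d0 [chain ap]]]]] B [conB disB adjB].
have exr (i : 'I_5) : exists u, u \in B i.
  have [j ij] : exists j : 'I_5, i != j.
    by case: (eqVneq i ord0) => [->|ne]; [exists ord_max | exists ord0].
  by have [u [v [uB _ _]]] := adjB i j (finset.in_setT _) (finset.in_setT _) ij; exists u.
have [r rB] := choice exr.
pose b i : 'I_5 := inord i.
have bne i j : (i < 5)%N -> (j < 5)%N -> i != j -> b i != b j.
  by move=> i5 j5; apply: contraNneq => /(congr1 (@nat_of_ord 5)); rewrite /b !inordK // => ->.
pose S i j := B (b i) :|: B (b j).
have cS i j : (i < j < 5)%N -> [/\ conn (adj E) (S i j), r (b i) \in S i j & r (b j) \in S i j].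
  move=> ij; split; rewrite ?inE ?rB ?orbT //.
  have ne : b i != b j by apply: bne; lia.
  have [u [v [uB vB uv]]] := adjB _ _ (finset.in_setT _) (finset.in_setT _) ne.
  by apply: (connU (@adj_sym n E) _ _ uB vB uv); apply: conB; rewrite finset.in_setT.
apply: (@K5_obstruction R d (fun i => pos (r (b i))) (fun i j => c (r (b i)) (r (b j)) (S i j)) d0).
  by move=> i j /cS[? ? ?]; exact: chain.
move=> i j k l ij kl u; have [? ? ?] := cS _ _ ij; have [? ? ?] := cS _ _ kl.
apply: ap => //; apply/pred0P => x /=; apply/negP => /andP[].
move: u; rewrite /= !inE !negb_or => /and4P[/and3P[_ ik il] /andP[jk jl] _ _].
have [[_ j5] [_ l5]] := (andP ij, andP kl).
have [i5 k5] : (i < 5)%N /\ (k < 5)%N by clear -ij kl; lia.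
by move=> /orP[] x1 /orP[] x2; have := disB _ _ x (finset.in_setT _) (finset.in_setT _) x1 x2;
apply/eqP/bne.
Qed.

Lemma planar_K33_free : planar R E -> K33_free (adj E).
Proof.
move=> /planar_chains[d [pos [c [d0 [chain ap]]]]] a1 a2 a3 ua.
rewrite leqNgt; apply/negP => /card_gt2P[b1 [b2 [b3 [[h1 h2 h3] [b12 b23 b31]]]]].
pose r := nth a1 [:: a1; a2; a3; b1; b2; b3].
pose S i j : {set 'I_n} := [set r i; r j]%SET.
have adjr i j : [&& i < 3, 3 <= j & j < 6]%N -> adj E (r i) (r j).
  move: h1 h2 h3; rewrite !inE => /and3P[? ? ?] /and3P[? ? ?] /and3P[? ? ?].
  by case: i j => [|[|[|i]]] [|[|[|[|[|[|j]]]]]] // _; rewrite adj_sym.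
have cS i j : [&& i < 3, 3 <= j & j < 6]%N -> [/\ conn (adj E) (S i j), r i \in S i j & r j \in S i j].
  move=> ij; split; rewrite ?inE ?eqxx ?orbT //.
  apply: (@connU _ _ (@adj_sym n E) [set r i]%SET [set r j]%SET (r i) (r j)); rewrite ?inE //.
  - exact: conn1.
  - exact: conn1.
  - exact: adjr.
have ur : uniq [:: a1; a2; a3; b1; b2; b3].
  move: ua h1 h2 h3; rewrite /= !inE !negb_or (eq_sym b1 b3) in b31 *.
  move=> /and3P[/andP[-> ->] -> _] /and3P[p1 p2 p3] /and3P[q1 q2 q3] /and3P[s1 s2 s3].
  have ne x y : adj E x y -> y != x by apply: contraTneq => ->; rewrite (adj_irr simE).
  by rewrite !(ne _ _ p1, ne _ _ p2, ne _ _ p3, ne _ _ q1, ne _ _ q2, ne _ _ q3,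
    ne _ _ s1, ne _ _ s2, ne _ _ s3) b12 b23 b31.
apply: (@K33_obstruction R d (fun i => pos (r i)) (fun i j => c (r i) (r j) (S i j)) d0).
  by move=> i j /cS[? ? ?]; exact: chain.
move=> i j k l ij kl u; have [? ? ?] := cS _ _ ij; have [? ? ?] := cS _ _ kl.
apply: ap => //; apply/pred0P => x /=; apply/negP; rewrite !inE => /andP[].
move: u; rewrite /= !inE !negb_or => /and4P[/and3P[_ ik il] /andP[jk jl] _ _].
have [[_ _ j6] [_ _ l6]] := (and3P ij, and3P kl).
have [i6 k6] : (i < 6)%N /\ (k < 6)%N by clear -ij kl; lia.
have nthE p q : (p < 6)%N -> (q < 6)%N -> (r p == r q) = (p == q).
  by move=> p6 q6; rewrite nth_uniq.
by move=> /orP[] /eqP-> /orP[]; rewrite nthE // ?(negbTE ik) ?(negbTE il) ?(negbTE jk) ?(negbTE jl).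
Qed.

End Drawings.

(** * Joining two components *)

Section Redrawing.
Local Open Scope ring_scope.
Variables (R : realType) (n : nat) (E : {set {set 'I_n}}).
Hypothesis simE : simple_graph E.
Implicit Types (pos : 'I_n -> R * R) (arc : {set 'I_n} -> R -> R * R).

Definition drawn pos arc (x : R * R) : Prop :=
  (exists v, x = pos v) \/ (exists e t, [/\ e \in E, t \in `[0, 1] & x = arc e t]).

Lemma in0_01 : (0 : R) \in `[0, 1]. Proof. by rewrite in_itv /= lexx ler01. Qed.
Lemma in1_01 : (1 : R) \in `[0, 1]. Proof. by rewrite in_itv /= lexx ler01. Qed.
Lemma itvW01 (t : R) : t \in `]0, 1[ -> t \in `[0, 1].
Proof. by rewrite !in_itv /= => /andP[/ltW -> /ltW ->]. Qed.

Lemma continuous_simple_arc (g : R -> R * R) :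
  continuous g -> {in `[0, 1] &, injective g} -> simple_arc g.
Proof. by move=> cg ig; split=> //; exact: continuous_subspaceT. Qed.

(** Continuity and injectivity are asked on drawn points only, which admits an inversion whose
    centre lies off the drawing. *)
Lemma map_drawing pos arc (phi : R * R -> R * R) :
    plane_drawing E pos arc ->
    (forall x, drawn pos arc x -> {for x, continuous phi}) ->
    (forall x y, drawn pos arc x -> drawn pos arc y -> phi x = phi y -> x = y) ->
  plane_drawing E (phi \o pos) (fun e => phi \o arc e \o @clamp R) /\
  (forall e, e \in E -> continuous (phi \o arc e \o @clamp R)).
Proof.
move=> [ipos sarc ends int dis] cphi iphi.
have dv v : drawn pos arc (pos v) by left; exists v.
have da e t : e \in E -> t \in `[0, 1] -> drawn pos arc (arc e t) by move=> eE ti; right; exists e, t.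
have cont e : e \in E -> continuous (phi \o arc e \o @clamp R).
  move=> eE t; case: (sarc e eE) => ce _.
  apply: (@continuous_comp _ _ _ (arc e \o @clamp R) phi); first exact: continuous_comp_clamp.
  by apply: cphi; apply: da => //; exact: clamp_in.
split=> //; split.
- by move=> u v /= /iphi uv; apply: ipos; exact: uv.
- move=> e eE; apply: continuous_simple_arc; first exact: cont.
  move=> s t si ti /=; rewrite !clamp_id //; case: (sarc e eE) => _ ie st.
  by apply: ie => //; apply: iphi => //; exact: da.
- move=> e eE; rewrite -(image_comp pos phi) -ends // image_setU !image_set1 /=.
  by rewrite !clamp_id ?in0_01 ?in1_01.
- move=> e v t eE ti /=; rewrite clamp_id; last exact: itvW01.
  move=> /iphi h; apply: (int e v t) => //; apply: h => //.
  by apply: da => //; exact: itvW01.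
- move=> e f s t eE fE ef si ti /=; rewrite !clamp_id ?itvW01 // => /iphi h.
  by apply: (dis e f s t) => //; apply: h; apply: da; rewrite // itvW01.
Qed.

Lemma orient_drawing pos arc (a : 'I_n) : plane_drawing E pos arc ->
  exists arc', [/\ plane_drawing E pos arc', (forall e, e \in E -> continuous (arc' e)) &
    forall e, e \in E -> a \in e -> arc' e 0 = pos a].
Proof.
move=> dr; have [ipos sarc ends int dis] := dr.
pose sg e (t : R) := if arc e 0 == pos a then t else 1 - t.
have sgi e t : t \in `[0, 1] -> sg e t \in `[0, 1].
  by rewrite /sg; case: ifP => // _; rewrite !in_itv /= => /andP[h1 h2]; apply/andP; split; lra.
have sgo e t : t \in `]0, 1[ -> sg e t \in `]0, 1[.
  by rewrite /sg; case: ifP => // _; rewrite !in_itv /= => /andP[h1 h2]; apply/andP; split; lra.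
have sginj e : injective (sg e) by rewrite /sg => s t; case: ifP => // _; lra.
have csg e : continuous (sg e).
  rewrite /sg; case: (arc e 0 == pos a) => t; first exact: cvg_id.
  by apply: cvgB; [exact: cvg_cst | exact: cvg_id].
exists (fun e => arc e \o @clamp R \o sg e).
have cont e : e \in E -> continuous (arc e \o @clamp R \o sg e).
  move=> eE t; case: (sarc e eE) => ce _.
  by apply: (@continuous_comp _ _ _ (sg e)); [exact: csg | exact: continuous_comp_clamp].
split=> //.
- split=> //.
  + move=> e eE; apply: continuous_simple_arc; first exact: cont.
    move=> s t si ti /=; rewrite !clamp_id; [|exact: sgi|exact: sgi]; case: (sarc e eE) => _ ie st.
    by apply: (sginj e); apply: ie => //; exact: sgi.
  + move=> e eE; rewrite -(ends e eE) /= !clamp_id; [|exact/sgi/in1_01|exact/sgi/in0_01]; rewrite /sg.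
    by case: ifP => //; rewrite subr0 subrr setUC.
  + move=> e v t eE ti /=; rewrite clamp_id; last exact/sgi/itvW01.
    by apply: int => //; exact: sgo.
  + move=> e f s t eE fE ef si ti /=.
    rewrite !clamp_id; [|exact/sgi/itvW01|exact/sgi/itvW01].
    by apply: dis => //; exact: sgo.
move=> e eE ae /=; rewrite clamp_id; last exact/sgi/in0_01.
rewrite /sg.
case: eqP => // ne; rewrite subr0.
have : (pos @` [set` e])%classic (pos a) by exists a.
by rewrite -ends // => -[/esym|/esym].
Qed.

End Redrawing.

(** * Straightening a drawing inside a small disc about a vertex *)

Section Tame.
Local Open Scope ring_scope.
Variable R : realType.

(** Take the last time at level at most [r], not the first: afterwards the arc must never re-enter
    the disc. *)
Lemma last_exit (f : R -> R) r : continuous f -> f 0 < r -> r < f 1 ->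
  exists c, [/\ c \in `]0, 1[, f c = r & forall t, c < t -> t <= 1 -> r < f t].
Proof.
move=> cf f0 f1.
pose A := (`[0, 1] `&` f @^-1` [set y | y <= r])%classic.
have cA : compact A.
  apply: compact_closedI; first exact: segment_compact.
  by apply: closed_comp; [move=> x _; exact: cf | exact: closed_le].
have A0 : A 0 by split=> /=; [exact: in0_01 | exact: ltW].
have [||| c] := @compact_EVT_max _ R id A; [by exists 0 | by [] | by apply: continuous_subspaceT => x; exact: cvg_id |].
rewrite inE => -[/= c01 fc] cmax.
have out t : c < t -> t <= 1 -> r < f t.
  move=> ct t1; rewrite ltNge; apply/negP => ft.
  have tA : A t.
    split=> //=; move: c01; rewrite !in_itv /= => /andP[c0 _].
    by rewrite t1 (le_trans c0) // ltW.
  by have := cmax t (mem_set tA); rewrite leNgt ct.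
have cN1 : c != 1 by apply/eqP => e; rewrite e leNgt f1 in fc.
have c1 : c < 1 by rewrite lt_neqAle cN1; move: c01; rewrite in_itv /= => /andP[].
have fcr : f c = r.
  apply/eqP; rewrite eq_le fc leNgt; apply/negP => fcr.
  have nr : nbhs (f c) [set y | y < r]%classic.
    by apply: open_nbhs_nbhs; split => //; exact: open_lt.
  have [e /= e0 He] := proj1 (nbhs_ballP _ _) (cf c _ nr).
  pose t := Num.min (c + e / 2) 1.
  have ct : c < t by rewrite lt_min c1 ltrDl divr_gt0.
  have t1 : t <= 1 by rewrite ge_min lexx orbT.
  have tle : t <= c + e / 2 by rewrite ge_min lexx.
  have : f t < r.
    apply: He; rewrite /ball /= distrC ger0_norm ?subr_ge0 ?ltW // ltrBlDl.
    by apply: (le_lt_trans tle); rewrite ltrD2l; lra.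
  by rewrite ltNge ltW // out.
exists c; split=> //.
have cN0 : c != 0 by apply/eqP => e; rewrite -fcr e ltxx in f0.
by rewrite in_itv /= c1 andbT lt_neqAle eq_sym cN0; move: c01; rewrite in_itv /= => /andP[].
Qed.

(* Up to time [c] the arc [h] is replaced by the segment from [a] to [h c]. *)
Definition radial (a : R * R) (h : R -> R * R) (c t : R) : R * R :=
  a + Num.min (t / c) 1 *: (h c - a) + (h (Num.max t c) - h c).

Lemma radial_in a h c t : 0 < c -> t <= c -> radial a h c t = a + (t / c) *: (h c - a).
Proof.
move=> c0 tc; rewrite /radial (max_idPr tc) subrr addr0 (min_idPl _) //.
by rewrite ler_pdivrMr // mul1r.
Qed.

Lemma radial_out a h c t : 0 < c -> c <= t -> radial a h c t = h t.
Proof.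
move=> c0 ct; rewrite /radial (max_idPl ct) (min_idPr _) ?ler_pdivlMr ?mul1r //.
by rewrite scale1r !subrKC.
Qed.

Lemma continuous_radial a h c : continuous h -> continuous (radial a h c).
Proof.
move=> ch t; apply: cvgD; last first.
  apply: cvgB; last exact: cvg_cst.
  apply: (@continuous_comp _ _ _ (fun t => Num.max t c) h); last exact: ch.
  by apply: (@continuous_max R R id (fun=> c) t); [exact: cvg_id | exact: cvg_cst].
apply: cvgD; first exact: cvg_cst.
apply: cvgZr_tmp.
apply: (@continuous_min R R (fun t => t / c) (fun=> 1) t); last exact: cvg_cst.
by apply: cvgM; [exact: cvg_id | exact: cvg_cst].
Qed.

Variables (n : nat) (E : {set {set 'I_n}}).
Hypothesis simE : simple_graph E.

(** The disc of radius [r] about [pos a] meets no other vertex and no arc of an edge avoiding [a].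
    Each arc at [a] is made radial up to its last exit: outer parts stay outside, and two radii meet
    only at the centre, since distinct arcs exit at distinct points. *)
Lemma radial_star (pos : 'I_n -> R * R) (arc : {set 'I_n} -> R -> R * R) (a : 'I_n) : plane_drawing E pos arc ->
  exists arc' (p : {set 'I_n} -> R * R) (r : R), [/\ 0 < r, plane_drawing E pos arc',
    forall e, e \in E -> a \in e -> `|p e - pos a| = r,
    forall v, v != a -> r < `|pos v - pos a| &
    forall e t, e \in E -> t \in `[0, 1] -> r < `|arc' e t - pos a| \/
       a \in e /\ exists k, [/\ 0 <= k, k <= 1 & arc' e t = pos a + k *: (p e - pos a)]].
Proof.
move=> /(orient_drawing a)[{}arc [dr cont orient]].
have [ipos sarc ends int dis] := dr.
have [d d0 Hd] := pieces_away simE dr.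
pose r := d / 2; have r0 : 0 < r by rewrite divr_gt0.
have rd : r < d by rewrite /r; lra.
clearbody r.
have n1 v : v != a -> r < `|pos v - pos a|.
  move=> va; apply: lt_le_trans rd _; rewrite -awayE.
  apply: (Hd (inl v) (inl a) 0 0) => //=.
  by rewrite disjoint_sym disjoints1 inE eq_sym.
have n2 e t : e \in E -> a \notin e -> t \in `[0, 1] -> r < `|arc e t - pos a|.
  move=> eE ae ti; apply: lt_le_trans rd _; rewrite -awayE -(clamp_id ti).
  by apply: (Hd (inr e) (inl a) t 0) => //=; rewrite disjoint_sym disjoints1.
pose P (e : {set 'I_n}) (c : R) := e \in E -> a \in e -> [/\ c \in `]0, 1[, `|arc e c - pos a| = r &
    forall t, c < t -> t <= 1 -> r < `|arc e t - pos a|].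
have [|c Hc] := @choice _ _ P.
  move=> e; rewrite /P; case: (boolP (e \in E)) => eE; last by exists 0.
  case: (boolP (a \in e)) => ae; last by exists 0.
  have cf : continuous (fun t => `|arc e t - pos a|).
    by move=> t; apply: cvg_norm; apply: cvgB; [exact: cont | exact: cvg_cst].
  have [||c Pc] := last_exit (r := r) cf; last by exists c.
    by rewrite orient // subrr normr0.
  have [v ve ev] := arc_end dr eE (or_intror (erefl (1 : R))).
  rewrite ev; apply: n1; apply/eqP => va; case: (sarc e eE) => _ inj.
  have : (1 : R) = 0 by apply: inj; rewrite ?in1_01 ?in0_01 // ev va orient.
  by move/eqP; rewrite oner_eq0.
pose arc' (e : {set 'I_n}) := if a \in e then radial (pos a) (arc e) (c e) else arc e.
pose p (e : {set 'I_n}) := arc e (c e).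
have K e t : e \in E -> t \in `[0, 1] ->
    (r < `|arc' e t - pos a| /\ arc' e t = arc e t) \/
    [/\ a \in e, 0 < c e, `|arc' e t - pos a| = t / c e * r, t / c e <= 1 &
      arc' e t = pos a + (t / c e) *: (p e - pos a)].
  move=> eE ti; rewrite /arc'; have [t0 t1] : 0 <= t /\ t <= 1 by apply/andP; move: ti; rewrite in_itv.
  case: (boolP (a \in e)) => ae; last first.
    by left; split=> //; exact: n2.
  have [] := Hc e eE ae; rewrite in_itv /= => /andP[c0 c1] hc out.
  case: (leP t (c e)) => tc; last first.
    by left; rewrite radial_out ?(ltW tc) //; split=> //; exact: out.
  right; rewrite radial_in // addrC addKr normrZ hc ger0_norm ?divr_ge0 ?(ltW c0) //.
  by split=> //; rewrite ?ler_pdivrMr ?mul1r // addrC.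
have le_r k : k <= 1 -> k * r <= r by move=> k1; rewrite ler_piMl // ltW.
exists arc', p, r; split=> //; last first.
- move=> e t eE ti; case: (K e t eE ti) => [[]|[ae c0 _ k1 ek]]; first by left.
  right; split=> //; exists (t / c e); split=> //.
  by rewrite divr_ge0 ?(ltW c0) //; move: ti; rewrite in_itv /= => /andP[].
- by move=> e eE ae; case: (Hc e eE ae).
have ca e : e \in E -> continuous (arc' e).
  move=> eE; rewrite /arc'; case: (a \in e); [apply: continuous_radial|]; exact: cont.
split=> //.
- move=> e eE; apply: continuous_simple_arc; first exact: ca.
  move=> s t si ti; case: (sarc e eE) => _ inj.
  case: (K e s eE si) => [[n1s es]|[ae c0 Ns ks es]]; case: (K e t eE ti) => [[n1t et]|[_ c0' Nt kt et]] st.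
  + by apply: inj => //; rewrite -es -et.
  + by move: n1s; rewrite st Nt ltNge le_r.
  + by move: n1t; rewrite -st Ns ltNge le_r.
  + have : s / c e * r = t / c e * r by rewrite -Ns -Nt st.
    by move/(mulIf (lt0r_neq0 r0))/(mulIf (invr_neq0 (lt0r_neq0 c0))).
- move=> e eE; rewrite -(ends e eE) /arc'; case: (boolP (a \in e)) => // ae.
  have [] := Hc e eE ae; rewrite in_itv /= => /andP[c0 c1] _ _.
  by rewrite radial_in ?(ltW c0) // mul0r scale0r addr0 radial_out ?(ltW c1) // orient.
- move=> e v t eE ti; have ti' := itvW01 ti.
  case: (K e t eE ti') => [[_ ->]|[ae c0 Nt kt et]]; first exact: int.
  move=> /(congr1 (fun x => `|x - pos a|)); rewrite Nt.
  case: (eqVneq v a) => [->|va].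
    move/eqP; rewrite subrr normr0 !mulf_eq0 invr_eq0 (gt_eqF r0) (gt_eqF c0) !orbF => /eqP t0.
    by move: ti; rewrite t0 in_itv /= ltxx.
  by move=> E1; have := n1 v va; rewrite -E1 ltNge le_r.
- move=> e f s t eE fE ef si ti; have si' := itvW01 si; have ti' := itvW01 ti.
  case: (K e s eE si') => [[n1s es]|[ae c0 Ns ks es]]; case: (K f t fE ti') => [[n1t et]|[af c0' Nt kt et]] st.
  + by apply: (dis e f s t) => //; rewrite -es -et.
  + by move: n1s; rewrite st Nt ltNge le_r.
  + by move: n1t; rewrite -st Ns ltNge le_r.
  + have : s / c e * r = t / c f * r by rewrite -Ns -Nt st.
    move/(mulIf (lt0r_neq0 r0)) => kk.
    have k0 : t / c f != 0.
      by rewrite mulf_neq0 ?invr_neq0 ?lt0r_neq0 //; move: ti; rewrite in_itv /= => /andP[].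
    have [ce _ _] := Hc e eE ae; have [cf _ _] := Hc f fE af.
    apply: (dis e f (c e) (c f)) => //; rewrite -/(p e) -/(p f).
    by move: st; rewrite es et kk => /addrI /(scalerI k0) /addIr.
Qed.

Lemma spoke (pos : 'I_n -> R * R) (arc : {set 'I_n} -> R -> R * R) (a : 'I_n) : plane_drawing E pos arc ->
  exists arc' u, [/\ plane_drawing E pos arc', u != 0 &
    forall k, 0 < k -> k <= 1 -> ~ drawn E pos arc' (pos a + k *: u)].
Proof.
move=> /(radial_star a)[arc' [p [r [r0 dr pr far near]]]].
(* Infinitely many points on one side of the square of radius [r], the norm being the maximum norm;
   the finitely many exit points miss one of them. *)
pose u (k : nat) : R * R := (r, r / k.+1%:R).
have normu k : `|u k| = r.
  rewrite prod_normE /= !ger0_norm ?divr_ge0 ?ltW //; apply/max_idPl.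
  by rewrite ler_pdivrMr ?ltr0n // ler_peMr ?ler1n // ltW.
have uinj k l : u k = u l -> k = l.
  by move=> [] /(mulfI (lt0r_neq0 r0)) /invr_inj /eqP; rewrite eqr_nat => /eqP[].
have [k Hk] : exists k, forall e, e \in E -> a \in e -> p e - pos a <> u k.
  apply: contrapT => no.
  have all k : exists e, [/\ e \in E, a \in e & p e - pos a = u k].
    by apply: contrapT => H; apply: no; exists k => e eE ae ek; apply: H; exists e.
  have [f Hf] := choice all.
  have : (#|[set f (val i) | i : 'I_(#|E|.+1)]%SET| <= #|E|)%N.
    apply/subset_leq_card/fintype.subsetP => _ /imsetP[i _ ->]; by case: (Hf i).
  rewrite card_imset ?card_ord ?ltnn // => i j ij; apply/val_inj/uinj.
  by case: (Hf (val i)) => _ _ <-; case: (Hf (val j)) => _ _ <-; rewrite /= in ij *; rewrite ij.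
exists arc', (u k); split=> //; first by rewrite -normr_gt0 normu.
move=> t t0 t1 h.
have nt : `|(pos a + t *: u k) - pos a| = t * r.
  by rewrite addrC addKr normrZ normu ger0_norm ?ltW.
have tr : t * r <= r by rewrite ler_piMl // ltW.
case: h => [[v ev]|[e [s [eE si ev]]]].
  case: (eqVneq v a) => [va|va]; last by have := far v va; rewrite -ev nt ltNge tr.
  move: nt; rewrite ev va subrr normr0 => /eqP.
  by rewrite eq_sym mulf_eq0 (gt_eqF r0) (gt_eqF t0).
case: (near e s eE si) => [|[ae [q [q0 q1 eq]]]]; first by rewrite -ev nt ltNge tr.
have qt : q = t.
  move: nt; rewrite ev eq addrC addKr normrZ (pr e eE ae) ger0_norm // => /mulIf; apply.
  exact: lt0r_neq0.
by apply: (Hk e eE ae); move: ev; rewrite eq qt => /addrI /(scalerI (lt0r_neq0 t0)) ->.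
Qed.

End Tame.

(** * Inversion exposing a vertex to infinity *)

Section Inversion.
Local Open Scope classical_set_scope.
Local Open Scope ring_scope.
Variable R : realType.

Definition sqn (w : R * R) : R := w.1 ^+ 2 + w.2 ^+ 2.

(* In complex notation, [x |-> d / conj (x - p)]. *)
Definition inversion (p d x : R * R) : R * R :=
  let w := x - p in
  ((w.1 * d.1 + w.2 * d.2) / sqn w, (w.1 * d.2 - w.2 * d.1) / sqn w).

Lemma sqn_gt0 w : w != 0 -> 0 < sqn w.
Proof.
move=> w0; rewrite lt_neqAle /sqn addr_ge0 ?sqr_ge0 // andbT eq_sym.
rewrite paddr_eq0 ?sqr_ge0 // !sqrf_eq0 -xpair_eqE -surjective_pairing; exact: w0.
Qed.

Lemma inversion_inj p d x y : d != 0 -> x != p -> y != p ->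
  inversion p d x = inversion p d y -> x = y.
Proof.
rewrite -subr_eq0 -(subr_eq0 x) -(subr_eq0 y) subr0 => /sqn_gt0 d0 /sqn_gt0 x0 /sqn_gt0 y0.
rewrite /inversion; move: (x - p) (y - p) (subrK p x) (subrK p y) x0 y0 => v w <- <- {x y} v0 w0 [e1 e2].
have nv : sqn v != 0 by rewrite gt_eqF.
have nw : sqn w != 0 by rewrite gt_eqF.
have nd : sqn d != 0 by rewrite gt_eqF.
(* The squared modulus of the image determines [sqn] of the point; the numerators then form an
   invertible linear system. *)
have id u : sqn u != 0 -> sqn d / sqn u =
    ((u.1 * d.1 + u.2 * d.2) / sqn u) ^+ 2 + ((u.1 * d.2 - u.2 * d.1) / sqn u) ^+ 2.
  by rewrite /sqn => nu; field.
have vw : sqn v = sqn w.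
  by apply/invr_inj/(mulfI nd); rewrite !id // e1 e2.
move: e1 e2; rewrite vw => /(mulIf (invr_neq0 nw)) e1 /(mulIf (invr_neq0 nw)) e2.
congr (_ + _); rewrite [LHS]surjective_pairing [RHS]surjective_pairing; congr (_, _); apply: (mulfI nd).
  have -> : sqn d * v.1 = d.1 * (v.1 * d.1 + v.2 * d.2) + d.2 * (v.1 * d.2 - v.2 * d.1) by rewrite /sqn; ring.
  by rewrite e1 e2 /sqn; ring.
have -> : sqn d * v.2 = d.2 * (v.1 * d.1 + v.2 * d.2) - d.1 * (v.1 * d.2 - v.2 * d.1) by rewrite /sqn; ring.
by rewrite e1 e2 /sqn; ring.
Qed.

Lemma inversion_ray (p d : R * R) s : d != 0 -> s != 0 -> inversion p d (p + s^-1 *: d) = (s, 0).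
Proof.
move=> /sqn_gt0 d0 s0; rewrite /inversion [p + _]addrC addrK /sqn /=.
have nd : sqn d != 0 by rewrite gt_eqF.
rewrite /sqn in nd; congr (_, _); rewrite /GRing.scale /=; field; rewrite ?s0 ?nd //.
Qed.

Lemma continuous_inversion p d x : x != p -> {for x, continuous (inversion p d)}.
Proof.
rewrite -subr_eq0 => /sqn_gt0 x0.
have c1 : (x' - p).1 @[x' --> x] --> (x - p).1.
  by apply: (cvg_comp _ fst (cvgB cvg_id (cvg_cst _)) cvg_fst).
have c2 : (x' - p).2 @[x' --> x] --> (x - p).2.
  by apply: (cvg_comp _ snd (cvgB cvg_id (cvg_cst _)) cvg_snd).
have cn : sqn (x' - p) @[x' --> x] --> sqn (x - p).
  by rewrite /sqn; apply: cvgD; rewrite ?expr2; apply: cvgM.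
have ci : (sqn (x' - p))^-1 @[x' --> x] --> (sqn (x - p))^-1.
  by apply: cvgV => //; rewrite gt_eqF.
have f1 : ((x' - p).1 * d.1 + (x' - p).2 * d.2) / sqn (x' - p) @[x' --> x] -->
          ((x - p).1 * d.1 + (x - p).2 * d.2) / sqn (x - p).
  by apply: cvgM => //; apply: cvgD; apply: cvgM => //; exact: cvg_cst.
have f2 : ((x' - p).1 * d.2 - (x' - p).2 * d.1) / sqn (x' - p) @[x' --> x] -->
          ((x - p).1 * d.2 - (x - p).2 * d.1) / sqn (x - p).
  by apply: cvgM => //; apply: cvgB; apply: cvgM => //; exact: cvg_cst.
exact: (cvg_pair f1 f2).
Qed.

Variables (n : nat) (E : {set {set 'I_n}}).
Hypothesis simE : simple_graph E.

(** [common_positive] wants conditions that persist when [d] shrinks, so the constant found is the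
    inverse of a bound. *)
Lemma drawing_bounded (pos : 'I_n -> R * R) arc : plane_drawing E pos arc ->
  exists M, forall x, drawn E pos arc x -> `|x| <= M.
Proof.
move=> [ipos sarc _ _ _].
pose P (i : 'I_n + {set 'I_n}) (d : R) := valid E i ->
  forall t, t \in `[0, 1] -> d * `|piece pos arc i t| <= 1.
have [||d d0 Hd] := @common_positive R _ P.
- by move=> i d e de Pe vi t ti; apply: le_trans (Pe vi t ti); rewrite ler_wpM2r.
- move=> i; rewrite /P; case: (boolP (valid E i)) => vi; last by exists 1.
  have ci : continuous (fun t => `|piece pos arc i t|).
    move=> t; apply: cvg_norm; case: i vi => [v|e] /= eE; first exact: cvg_cst.
    by case: (sarc e eE) => ce _; exact: continuous_comp_clamp.
  have [c _ cmax] := @EVT_max R _ 0 1 ler01 (continuous_subspaceT ci).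
  have M0 : 0 < 1 + `|piece pos arc i c| by rewrite ltr_pwDl.
  exists (1 + `|piece pos arc i c|)^-1; first by rewrite invr_gt0.
  move=> _ t ti; rewrite mulrC ler_pdivrMr // mul1r (le_trans (cmax t ti)) //.
  by rewrite lerDr.
exists d^-1 => x h; rewrite -[d^-1]mul1r ler_pdivlMr // mulrC.
case: h => [[v ->]|[e [t [eE ti ->]]]]; first exact: (Hd (inl v) isT 0 (in0_01 R)).
by have := Hd (inr e) eE t ti; rewrite /= clamp_id.
Qed.

(** Invert at the outer end [p] of the free spoke, where nothing is drawn: the spoke from [pos a]
    towards [p] becomes the half-line from (1, 0) to infinity. *)
Lemma spike (a : 'I_n) : planar R E -> exists pos arc M,
  [/\ @plane_drawing R n E pos arc, forall e, e \in E -> continuous (arc e), pos a = (1, 0),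
      forall x, drawn E pos arc x -> `|x| <= M &
      forall s, 1 < s -> ~ drawn E pos arc (s, 0)].
Proof.
move=> [pos [arc0 /(spoke simE a)[arc [u [dr u0 free]]]]].
pose p := pos a + u; pose phi := inversion p (- u).
have off x : drawn E pos arc x -> x != p.
  by move=> dx; apply/eqP => xp; apply: (free 1); rewrite ?ltr01 // scale1r -/p -xp.
have u0' : - u != 0 by rewrite oppr_eq0.
have injphi x y : drawn E pos arc x -> drawn E pos arc y -> phi x = phi y -> x = y.
  by move=> /off xp /off yp; exact: inversion_inj.
have [dr' cont'] := map_drawing dr (phi := phi) (fun x dx => continuous_inversion (off x dx)) injphi.
have [M HM] := drawing_bounded dr'.
exists (phi \o pos), (fun e => phi \o arc e \o @clamp R), M; split=> //.
  rewrite /= -(@inversion_ray p (- u) 1) ?oner_eq0 // /phi invr1 scale1r.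
  by rewrite /p addrK.
move=> s s1 h.
have s0 : 0 < s by apply: lt_trans s1.
pose y := p + s^-1 *: - u.
have ephi : phi y = (s, 0) by apply: inversion_ray; rewrite ?gt_eqF.
have yE : y = pos a + (1 - s^-1) *: u.
  by rewrite /y /p scalerN scalerBl scale1r addrA.
have dy x : drawn E pos arc x -> phi x = (s, 0) -> drawn E pos arc y.
  move=> dx ex; suff <- : x = y by [].
  apply: (@inversion_inj p (- u)) => //; first exact: off.
    by rewrite /y -subr_eq0 addrC addKr scaler_eq0 invr_eq0 (gt_eqF s0) (negbTE u0').
  by rewrite -/(phi x) ex -ephi.
have : drawn E pos arc y.
  case: h => [[v ev]|[e [t [eE ti ev]]]].
    by apply: (dy (pos v)); [left; exists v | rewrite ev].
  by apply: (dy (arc e (clamp t))); [right; exists e, (clamp t); split=> //; exact: clamp_in | rewrite ev].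
by rewrite yE; apply: free; rewrite ?subr_gt0 ?invf_lt1 // gerBl invr_ge0 ltW.
Qed.

End Inversion.

Section Join.
Local Open Scope ring_scope.
Variables (R : realType) (n : nat) (E : {set {set 'I_n}}).
Hypothesis simE : simple_graph E.

Lemma continuous_pair (T : topologicalType) (f g : T -> R) :
  continuous f -> continuous g -> continuous (fun x => (f x, g x)).
Proof. by move=> cf cg x; exact: (cvg_pair (cf x) (cg x)). Qed.

Lemma edge_pair e : e \in E -> exists u v, e = [set u; v]%SET.
Proof. by move=> /(forall_inP simE) /cards2P[u [v [_ ->]]]; exists u, v. Qed.

(* The two spiked drawings are placed side by side, the second one mirrored,
   and the tips [(1, 0)] and [(T - 1, 0)] are joined by a segment. *)
Lemma planar_join (a b : 'I_n) : planar R E -> ~~ connect (adj E) a b ->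
  planar R ([set a; b]%SET |: E).
Proof.
move=> plE nab.
have [pos1 [arc1 [M1 [dr1 cont1 a1 le1 free1]]]] := spike simE a plE.
have [pos2 [arc2 [M2 [dr2 cont2 b2 le2 free2]]]] := spike simE b plE.
pose C v := connect (adj E) a v.
have Ca : C a := connect0 _ _.
have nCb : C b = false := negbTE nab.
have abE : [set a; b]%SET \notin E by apply: contra nab => abE; exact: connect1.
have Cadj u v : [set u; v]%SET \in E -> C u = C v.
  by move=> uv; apply: (same_connect1r (sym_connect_sym (@adj_sym n E))).
pose side (e : {set 'I_n}) := [forall v in e, C v].
have sideC e v : e \in E -> v \in e -> C v = side e.
  move=> eE ve; have [u [w ew]] := edge_pair eE; have Cuw : C u = C w by apply: Cadj; rewrite -ew.
  rewrite /side; apply/idP/forall_inP => [Cv x|]; last exact.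
  by move: ve; rewrite ew !inE => /orP[]/eqP ev /orP[]/eqP->; rewrite ?Cuw -?Cuw -?ev ?Cuw //; move: Cv; rewrite ev ?Cuw.
have M1_1 : 1 <= M1.
  have : `|pos1 a| <= M1 by apply: le1; left; exists a.
  by rewrite a1 prod_normE /= normr1 normr0 ge_max => /andP[].
have M2_1 : 1 <= M2.
  have : `|pos2 b| <= M2 by apply: le2; left; exists b.
  by rewrite b2 prod_normE /= normr1 normr0 ge_max => /andP[].
(* The first drawing has abscissae at most [M1]; with this shift the mirrored second one has
   abscissae greater than [M1]. *)
pose T := M1 + M2 + 1.
have T2 : 0 < T - 2 by rewrite /T; lra.
pose psi (x : R * R) : R * R := (T - x.1, x.2).
have psi_inj : injective psi by move=> [x y] [x' y'] [h ->]; congr (_, _); lra.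
(* Both spiked drawings show all of [E]; the component of [a] is kept from the first and everything
   else from the second. *)
pose pos v := if C v then pos1 v else psi (pos2 v).
pose arc (e : {set 'I_n}) : R -> R * R :=
  if e == [set a; b]%SET then fun t => (1 + t * (T - 2), 0)
  else if side e then arc1 e else psi \o arc2 e.
have left1 x : drawn E pos1 arc1 x -> x.1 <= M1.
  move=> /le1; rewrite prod_normE ge_max => /andP[h _]; exact: le_trans (ler_norm _) h.
have right2 x : drawn E pos2 arc2 x -> M1 < (psi x).1.
  move=> /le2; rewrite prod_normE ge_max => /andP[h _].
  have := le_trans (ler_norm _) h; rewrite /psi /T /=; lra.
have dv1 v : drawn E pos1 arc1 (pos1 v) by left; exists v.
have dv2 v : drawn E pos2 arc2 (pos2 v) by left; exists v.
have de1 e t : e \in E -> t \in `]0, 1[ -> drawn E pos1 arc1 (arc1 e t).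
  by move=> eE ti; right; exists e, t; split=> //; exact: itvW01.
have de2 e t : e \in E -> t \in `]0, 1[ -> drawn E pos2 arc2 (arc2 e t).
  by move=> eE ti; right; exists e, t; split=> //; exact: itvW01.
have apart x y : drawn E pos1 arc1 x -> drawn E pos2 arc2 y -> x <> psi y.
  by move=> /left1 hx /right2 hy xy; move: hy; rewrite -xy ltNge hx.
have arcab : arc [set a; b]%SET = fun t => (1 + t * (T - 2), 0) by rewrite /arc eqxx.
have arcE e : e \in E -> arc e = if side e then arc1 e else psi \o arc2 e.
  by move=> eE; rewrite /arc; case: eqP => // ee; move: abE; rewrite -ee eE.
have spoke1 x t : drawn E pos1 arc1 x -> t \in `]0, 1[ -> (1 + t * (T - 2), 0) <> x.
  rewrite in_itv /= => dx /andP[t0 t1] ex; apply: (free1 (1 + t * (T - 2))); last by rewrite ex.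
  by rewrite ltrDl mulr_gt0.
have spoke2 x t : drawn E pos2 arc2 x -> t \in `]0, 1[ -> (1 + t * (T - 2), 0) <> psi x.
  rewrite in_itv /= => dx /andP[t0 t1] ex; apply: (free2 (T - (1 + t * (T - 2)))).
    have : 0 < (1 - t) * (T - 2) by rewrite mulr_gt0 // subr_gt0.
    by lra.
  by move: dx; rewrite (_ : x = (T - (1 + t * (T - 2)), 0)) //; apply: psi_inj; rewrite -ex /psi /=; congr (_, _); ring.
have [ip1 sa1 ends1 int1 dis1] := dr1; have [ip2 sa2 ends2 int2 dis2] := dr2.
have disab f s t : f \in E -> s \in `]0, 1[ -> t \in `]0, 1[ -> arc [set a; b]%SET s <> arc f t.
  move=> fE si ti; rewrite arcab arcE //; case: (side f); last by apply: spoke2 => //; exact: de2.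
  by apply: spoke1 => //; exact: de1.
exists pos, arc; split.
- move=> u v; rewrite /pos; case: (C u); case: (C v).
  + exact: ip1.
  + by move=> /apart [].
  + by move=> /esym /apart [].
  + by move=> /psi_inj; exact: ip2.
- move=> e; rewrite in_setU1 => /orP[/eqP->|eE].
    rewrite arcab; apply: continuous_simple_arc.
      apply: continuous_pair => t; last exact: cvg_cst.
      by apply: cvgD; [exact: cvg_cst | apply: cvgM; [exact: cvg_id | exact: cvg_cst]].
    by move=> s t _ _ [] /addrI /(mulIf (lt0r_neq0 T2)).
  rewrite arcE //; case: (side e); first exact: sa1.
  apply: continuous_simple_arc; last first.
    by move=> s t si ti /= /psi_inj; case: (sa2 e eE) => _; apply.
  move=> t; apply: (@continuous_comp _ _ _ (arc2 e) psi); first exact: cont2.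
  apply: continuous_pair => x; last exact: cvg_snd.
  by apply: cvgB; [exact: cvg_cst | exact: cvg_fst].
- move=> e; rewrite in_setU1 => /orP[/eqP->|eE].
    rewrite arcab /= mul0r addr0 mul1r.
    have -> : (1 : R, 0 : R) = pos a by rewrite /pos Ca a1.
    have -> : (1 + (T - 2), 0) = pos b by rewrite /pos nCb b2 /psi /=; congr (_, _); ring.
    apply/seteqP; split=> x /=.
      by move=> [->|->]; [exists a | exists b]; rewrite //= !inE eqxx ?orbT.
    by move=> [v]; rewrite !inE => /orP[/eqP->|/eqP->] <-; [left | right].
  rewrite arcE //; case: (boolP (side e)) => se.
    rewrite ends1 //; apply: eq_imagel => v ve.
    by rewrite /pos (sideC e) // se.
  transitivity (psi @` (pos2 @` [set` e])%classic)%classic.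
    by rewrite -ends2 // image_setU !image_set1.
  rewrite image_comp; apply: eq_imagel => v ve.
  by rewrite /pos (sideC e) // (negbTE se).
- move=> e v t; rewrite in_setU1 => /orP[/eqP->|eE] ti.
    by rewrite arcab /pos; case: (C v); [exact: spoke1 | exact: spoke2].
  rewrite arcE // /pos; case: (side e); case: (C v).
  + exact: int1.
  + by apply: apart => //; exact: de1.
  + by apply/nesym/apart => //; exact: de2.
  + by move=> /psi_inj; exact: int2.
- move=> e f s t; rewrite !in_setU1 => /orP[/eqP->|eE] /orP[/eqP->|fE] ef si ti.
  + by [].
  + exact: disab.
  + exact/nesym/disab.
  rewrite !arcE //; case: (side e); case: (side f).
  + exact: dis1.
  + by apply: apart; [exact: de1 | exact: de2].
  + by apply/nesym/apart; [exact: de1 | exact: de2].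
  + by move=> /psi_inj; exact: dis2.
Qed.

Lemma planar_sub (F : {set {set 'I_n}}) : F \subset E -> planar R E -> planar R F.
Proof.
move=> /fintype.subsetP FE [pos [arc [ip sa ends int dis]]]; exists pos, arc; split=> //.
- by move=> e /FE; exact: sa.
- by move=> e /FE; exact: ends.
- by move=> e v t /FE; exact: int.
- by move=> e f s t /FE eE /FE fE; exact: dis.
Qed.

End Join.

(** * A planar graph with 3n - 6 edges *)

Section BipyramidDrawing.
Local Open Scope ring_scope.
Variable R : realType.

(* Two poles 0 and 1, both joined to the path 2, 3, ... on a vertical line. *)
Definition bip_pos (u : nat) : R * R :=
  if u is u'.+2 then (0, u%:R) else if u is 0 then (-1, 0) else (1, 0).

Definition bip_edge (u v : nat) : bool := (u < v)%N && ((u <= 1)%N || (v == u.+1)).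

Definition bip_line (u v : nat) (t : R) : R * R := bip_pos u + t *: (bip_pos v - bip_pos u).

Lemma natr_fract_inj (u v : nat) (s t : R) : 0 < s -> s < 1 -> 0 < t -> t < 1 ->
  u%:R + s = v%:R + t -> u = v.
Proof.
move=> s0 s1 t0 t1 e; case: (ltngtP u v) => // lt; exfalso.
  by have : (u.+1%:R : R) <= v%:R; [rewrite ler_nat | rewrite -natr1; lra].
by have : (v.+1%:R : R) <= u%:R; [rewrite ler_nat | rewrite -natr1; lra].
Qed.

Lemma bip_pos_inj : injective bip_pos.
Proof.
move=> [|[|u]] [|[|v]] //= [].
all: try by move=> *; exfalso; lra.
by move/eqP; rewrite eqr_nat => /eqP.
Qed.

(** Coordinates on the straight edges. The pole edge crosses the vertical line at height 0, below
    the path, which starts at height 2. *)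
Variant bip_line_spec (t : R) : nat -> nat -> R * R -> Prop :=
| BipPoles : bip_line_spec t 0 1 (2 * t - 1, 0)
| BipLeft v of (0 < v)%N : bip_line_spec t 0 v.+1 (t - 1, t * v.+1%:R)
| BipRight v of (0 < v)%N : bip_line_spec t 1 v.+1 (1 - t, t * v.+1%:R)
| BipPath u of (1 < u)%N : bip_line_spec t u u.+1 (0, u%:R + t).

Lemma bip_lineP u v t : bip_edge u v -> bip_line_spec t u v (bip_line u v t).
Proof.
rewrite /bip_edge => /andP[uv cond].
have ext (x y : R * R) : x.1 = y.1 -> x.2 = y.2 -> x = y.
  by case: x y => [x1 x2] [y1 y2] /= -> ->.
case: u uv cond => [|[|u]].
- case: v => [|[|v]] // _ _.
    have -> : bip_line 0 1 t = (2 * t - 1, 0) by apply: ext; rewrite /= /GRing.scale /=; ring.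
    exact: BipPoles.
  have -> : bip_line 0 v.+2 t = (t - 1, t * v.+2%:R) by apply: ext; rewrite /= /GRing.scale /=; ring.
  exact: BipLeft.
- case: v => [|[|v]] // _ _.
  have -> : bip_line 1 v.+2 t = (1 - t, t * v.+2%:R) by apply: ext; rewrite /= /GRing.scale /=; ring.
  exact: BipRight.
- move=> _ /= /eqP ->.
  have -> : bip_line u.+2 u.+3 t = (0, u.+2%:R + t).
    by apply: ext; rewrite /= /GRing.scale /= -?(natr1 _ u.+2); ring.
  exact: BipPath.
Qed.

Lemma bip_line_vertex u v w t : bip_edge u v -> 0 < t -> t < 1 -> bip_line u v t <> bip_pos w.
Proof.
move=> uv t0 t1; case: (bip_lineP t uv) => [|v' v0|v' v0|u' u0].
- by case: w => [|[|w]] /= []; try lra; move=> _ /eqP; rewrite eq_sym pnatr_eq0.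
- by case: w => [|[|w]] /= []; lra.
- by case: w => [|[|w]] /= []; lra.
- case: w => [|[|w]] /= []; try lra.
  move=> e; have ltw : (u'%:R : R) < w.+2%:R by lra.
  have : (u'.+1%:R : R) <= w.+2%:R by rewrite ler_nat -(ltr_nat R).
  by rewrite -natr1; lra.
Qed.

Lemma bip_line_disjoint u v u' v' s t : bip_edge u v -> bip_edge u' v' ->
  0 < s -> s < 1 -> 0 < t -> t < 1 -> bip_line u v s = bip_line u' v' t -> u = u' /\ v = v'.
Proof.
move=> uv uv' s0 s1 t0 t1.
have pos w : (0 : R) < w.+1%:R by rewrite ltr0Sn.
have natI (x y : nat) : x.+1%:R = y.+1%:R :> R -> x.+1 = y.+1.
  by move/eqP; rewrite eqr_nat => /eqP.
case: (bip_lineP s uv) => [|w w0|w w0|w w0]; case: (bip_lineP t uv') => [|z z0|z z0|z z0] [].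
all: try by move=> *; split.
all: try by move=> *; exfalso; lra.
- by move=> _ /eqP; rewrite eq_sym mulf_eq0 (gt_eqF t0) (gt_eqF (pos _)).
- by move=> _ /eqP; rewrite eq_sym mulf_eq0 (gt_eqF t0) (gt_eqF (pos _)).
- by move=> _ e; exfalso; have := ler0n R z; lra.
- by move=> _ /eqP; rewrite mulf_eq0 (gt_eqF s0) (gt_eqF (pos _)).
- by move=> /addIr -> /(mulfI (lt0r_neq0 t0)) /natI ->.
- by move=> _ /eqP; rewrite mulf_eq0 (gt_eqF s0) (gt_eqF (pos _)).
- by move=> /addrI /oppr_inj -> /(mulfI (lt0r_neq0 t0)) /natI ->.
- by move=> _ e; exfalso; have := ler0n R w; lra.
- by move=> e; rewrite (natr_fract_inj s0 s1 t0 t1 e).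
Qed.

Definition bip_pairs n : {set 'I_n * 'I_n} := [set p : 'I_n * 'I_n | bip_edge p.1 p.2]%SET.
Definition bip_graph n : {set {set 'I_n}} := [set [set p.1; p.2] | p in bip_pairs n]%SET.

Lemma bip_pair_inj n : {in bip_pairs n &, injective (fun p : 'I_n * 'I_n => [set p.1; p.2]%SET)}.
Proof.
move=> [u v] [u' v']; rewrite !inE /= => /andP[uv _] /andP[uv' _] e.
have : (u \in [set u'; v']%SET) && (v \in [set u'; v']%SET) by rewrite -e !inE !eqxx orbT.
by rewrite !inE => /andP[/orP[]/eqP eu /orP[]/eqP ev]; move: uv uv'; rewrite eu ev //; lia.
Qed.

Lemma simple_bip_graph n : simple_graph (bip_graph n).
Proof.
apply/forall_inP => e /imsetP[p]; rewrite inE => /andP[lt _] ->.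
have ne : p.1 != p.2 by apply: contraTneq lt => ->; rewrite ltnn.
by rewrite cards2 ne.
Qed.

Lemma planar_bip_graph n : planar R (bip_graph n).
Proof.
pose arc (e : {set 'I_n}) := if [pick p : 'I_n * 'I_n in bip_pairs n | e == [set p.1; p.2]%SET] is Some p
  then bip_line p.1 p.2 else fun=> 0.
have arcP e : e \in bip_graph n -> exists p, [/\ bip_edge (val p.1) (val p.2),
    e = [set p.1; p.2]%SET & arc e = bip_line p.1 p.2].
  rewrite /arc; case: pickP => [p /andP[]|no /imsetP[p pin ep]].
    by rewrite inE => pin /eqP ep _; exists p.
  by have := no p; rewrite pin ep eqxx.
have in01 (t : R) : t \in `]0, 1[ -> 0 < t /\ t < 1 by rewrite in_itv => /andP.
exists (fun v => bip_pos v), arc; split.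
- by move=> u v /bip_pos_inj /val_inj.
- move=> e /arcP[[u v] [uv _ ->]]; apply: continuous_simple_arc.
    move=> t; apply: cvgD; first exact: cvg_cst.
    by apply: cvgZr_tmp; exact: cvg_id.
  move=> s t _ _ /addrI /eqP; rewrite -subr_eq0 -scalerBl scaler_eq0 => /orP[|].
    by rewrite subr_eq0 => /eqP.
  by rewrite subr_eq0 => /eqP /bip_pos_inj vu; move: uv; rewrite /= vu /bip_edge ltnn.
- move=> e /arcP[[u v] [uv -> ->]]; rewrite /bip_line scale0r addr0 scale1r subrKC /=.
  apply/seteqP; split=> x /=.
    by move=> [->|->]; [exists u | exists v]; rewrite //= !inE eqxx ?orbT.
  by move=> [w]; rewrite !inE => /orP[/eqP->|/eqP->] <-; [left | right].
- move=> e w t /arcP[[u v] [uv _ ->]] /in01[t0 t1]; exact: bip_line_vertex.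
- move=> e f s t /arcP[[u v] [uv ee ->]] /arcP[[u' v'] [uv' ef ->]] nef /in01[s0 s1] /in01[t0 t1].
  move=> /(bip_line_disjoint uv uv' s0 s1 t0 t1)[/val_inj eu /val_inj ev].
  by apply: nef; rewrite ee ef; move: eu ev => /= -> ->.
Qed.

(** For [n] at least 3 there are [n - 1] edges at pole 0, [n - 2] more at pole 1 and [n - 3] on the
    path. *)
Lemma card_bip_graph n : (3 * n - 6 <= #|bip_graph n|)%N.
Proof.
rewrite (card_in_imset (@bip_pair_inj n)).
case: n => [|[|[|k]]] //.
pose f (i : 'I_k.+2 + ('I_k.+1 + 'I_k)) : 'I_k.+3 * 'I_k.+3 :=
  match i with
  | inl i => (inord 0, inord i.+1)
  | inr (inl i) => (inord 1, inord i.+2)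
  | inr (inr i) => (inord i.+2, inord i.+3)
  end.
have v0 : (inord 0 : 'I_k.+3) = 0 :> nat by rewrite inordK.
have v1 : (inord 1 : 'I_k.+3) = 1 :> nat by rewrite inordK.
have w1 (i : 'I_k.+2) : (inord i.+1 : 'I_k.+3) = i.+1 :> nat by rewrite inordK //; have := ltn_ord i; lia.
have w2 (i : 'I_k.+1) : (inord i.+2 : 'I_k.+3) = i.+2 :> nat by rewrite inordK //; have := ltn_ord i; lia.
have w3 (i : 'I_k) : (inord i.+2 : 'I_k.+3) = i.+2 :> nat by rewrite inordK //; have := ltn_ord i; lia.
have w4 (i : 'I_k) : (inord i.+3 : 'I_k.+3) = i.+3 :> nat by rewrite inordK //; have := ltn_ord i; lia.
have finj : injective f.
  move=> [i|[i|i]] [j|[j|j]]; rewrite /f => /eqP; rewrite xpair_eqE;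
  move=> /andP[/eqP /(congr1 val) e1 /eqP /(congr1 val) e2]; move: e1 e2;
  rewrite /= ?v0 ?v1 ?w1 ?w2 ?w3 ?w4 //.
  - by move=> _ [] /val_inj ->.
  - by move=> _ [] /val_inj ->.
  - by move=> _ [] /val_inj ->.
rewrite (_ : 3 * k.+3 - 6 = #|[set f i | i : 'I_k.+2 + ('I_k.+1 + 'I_k)]%SET|)%N; last first.
  by rewrite card_imset // !card_sum !card_ord; lia.
apply/subset_leq_card/fintype.subsetP => _ /imsetP[i _ ->]; rewrite inE.
by case: i => [i|[i|i]]; rewrite /bip_edge /= ?v0 ?v1 ?w1 ?w2 ?w3 ?w4 ?eqxx ?leqnn ?orbT.
Qed.

(** Any [m] edges of the bipyramid will do. Since [uniform_prob] is 0 on an empty set, the limit 1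
    depends on this. *)
Lemma planar_graphs_neq0 n m : (m%:Z <= 3 * n%:Z - 6)%R -> planar_graphs R n m%:Z != finset.set0.
Proof.
move=> le_m; have lem : (m <= #|bip_graph n|)%N.
  by apply: leq_trans (card_bip_graph n); lia.
pose F := [set e in take m (enum (bip_graph n))]%SET.
have FE : F \subset bip_graph n.
  by apply/fintype.subsetP => e; rewrite inE => /mem_take; rewrite mem_enum.
apply/set0Pn; exists F; rewrite inE; apply/and3P; split.
- by apply/forall_inP => e /(fintype.subsetP FE); move: e; apply/forall_inP/simple_bip_graph.
- by apply/asboolP; apply: planar_sub FE _; exact: planar_bip_graph.
- rewrite eqz_nat cardsE; apply/eqP.
  by rewrite (card_uniqP _) ?take_uniq ?enum_uniq // size_takel // -cardE.
Qed.

End BipyramidDrawing.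

(** * The limit *)

Local Open Scope classical_set_scope.
Local Open Scope ring_scope.

Lemma exchange_planar (R : realType) n m (E : {set {set 'I_n}}) e a b :
  E \in planar_graphs R n m -> e \in E -> ~~ connect (adj E) a b ->
  ([set a; b] |: (E :\ e))%SET \in planar_graphs R n m.
Proof.
rewrite !inE => /and3P[simE /asboolP plE /eqP cE] eE nab.
have abE : [set a; b]%SET \notin E by apply: contra nab => abE; exact: connect1.
have aNb : a != b by apply: contraNneq nab => ->; exact: connect0.
apply/and3P; split.
- apply/forall_inP => f; rewrite in_setU1 => /orP[/eqP->|]; first by rewrite cards2 aNb.
  by rewrite in_setD1 => /andP[_ fE]; exact: (forall_inP simE).
- apply/asboolP; apply: planar_sub (planar_join simE plE nab).
  by apply: finset.setUS; exact: finset.subD1set.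
- by rewrite cardsU1 in_setD1 (negbTE abE) andbF /= -cE (cardsD1 e E) eE.
Qed.

Lemma disconnected_fraction (R : realType) n m s : (m + s = 3 * n)%N ->
    (4000 * 1000 * s <= n)%N -> (0 < n)%N -> planar_graphs R n m%:Z != finset.set0 ->
  0 <= 1 - prob_connected R n m%:Z <= (s%:R / n%:R) * (2736 * (684 * 684)).
Proof.
move=> ms large n0 P0; rewrite /prob_connected /uniform_prob.
set P := planar_graphs R n m%:Z in P0 *.
pose D := [set E in P | ~~ connected_graph E]%SET.
have memP E : E \in P -> [/\ simple_graph E, planar R E & #|E| = m].
  by rewrite inE => /and3P[h1 /asboolP h2 /eqP[h3]].
have le_D : (#|D| * n <= #|P| * (s * (2736 * (684 * 684))))%N.
  apply: (@disconnected_bound n m s) => //.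
  - by move=> E /memP[].
  - by move=> E /memP[].
  - by move=> E /memP[simE plE _]; exact: planar_K5_free plE.
  - by move=> E /memP[simE plE _]; exact: planar_K33_free plE.
  - by move=> E e a b; exact: exchange_planar.
have cP : (#|[set E in P | connected_graph E]%SET| + #|D| = #|P|)%N.
  rewrite -(cardsID [set E | connected_graph E]%SET P).
  by congr (_ + _)%N; apply: eq_card => E; rewrite !inE // andbC.
have P1 : (0 : R) < #|P|%:R by rewrite ltr0n card_gt0.
have -> : 1 - #|[set E in P | connected_graph E]%SET|%:R / #|P|%:R = #|D|%:R / #|P|%:R :> R.
  by rewrite -{1}(divff (lt0r_neq0 P1)) -mulrBl -{1}cP natrD addrC addKr.
rewrite divr_ge0 ?ler0n //= ler_pdivrMr // -mulrA mulrC mulrA.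
move: le_D; rewrite -(ler_nat R) !natrM => le_D.
have n1 : (0 : R) < n%:R by rewrite ltr0n.
rewrite -(ler_pM2r n1) (le_trans le_D) //.
by rewrite le_eqVlt; apply/orP; left; apply/eqP; field; rewrite lt0r_neq0.
Qed.

Theorem theorem4p3 (R : realType) (m : nat -> int)
    (m_le : \forall n \near \oo, m n <= 3 * n%:Z - 6)
    (m_asymp : (fun n : nat => (m n)%:~R : R) =
               (fun n : nat => 3 * n%:R : R) +o_\oo (fun n : nat => n%:R : R)) :
  prob_connected R n (m n) @[n --> \oo] --> (1 : R).
Proof.
move/eqaddoP: m_asymp => small.
apply/cvgrPdist_le => eps eps0.
pose K : R := 2736 * (684 * 684).
have K0 : 0 < K by rewrite !(mulr_gt0, ltr0n).
have frac := @disconnected_fraction R; rewrite -/K in frac; move: K K0 frac => K K0 frac.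
have [c [c0 c1 cE]] : exists c : R, [/\ 0 < c, 1 <= c &
    forall k, (4000 * 1000 * k)%:R = c * k%:R :> R].
  exists (4000 * 1000); split; first by rewrite mulr_gt0 ?ltr0n.
    by rewrite -natrM ler1n muln_gt0.
  by move=> k; rewrite !natrM.
(* The first term secures [4000 * 1000 * s <= n], the second makes [K * s / n] at most [eps]. *)
pose d := Num.min c^-1 (eps / K).
have d0 : 0 < d by rewrite lt_min invr_gt0 c0 divr_gt0.
near=> n.
have n0 : (0 < n)%N by near: n; exact: nbhs_infty_gt.
have n1 : (0 : R) < n%:R by rewrite ltr0n.
have le_m : m n <= 3 * n%:Z - 6 by near: n.
have close_m : `|(m n)%:~R - 3 * n%:R : R| <= d * `|n%:R : R| by near: n; exact: small.
rewrite (ger0_norm (ler0n R n)) in close_m.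
have d1 : d <= c^-1 by rewrite ge_min lexx.
have dK : d <= eps / K by rewrite ge_min lexx orbT.
have dn : d * n%:R <= c^-1 * n%:R by rewrite ler_wpM2r // ltW.
have nn : c^-1 * n%:R <= n%:R :> R by rewrite ler_piMl ?ler0n ?invf_le1.
(* As [d] is at most 1, [m n] differs from [3 * n] by at most [n]. *)
have m0 : 0 <= m n.
  rewrite -(ler0z R); move: close_m; rewrite ler_norml => /andP[h _]; lra.
have [k mk] : exists k : nat, m n = k%:Z by exists `|m n|%N; rewrite gez0_abs.
rewrite mk in le_m close_m *.
have lek : (k <= 3 * n)%N by clear -le_m; lia.
have [s ms] : exists s : nat, (k + s = 3 * n)%N by exists (3 * n - k)%N; rewrite subnKC.
have sR : (s%:R : R) = 3 * n%:R - k%:R by rewrite -[3]/(3%:R) -natrM -ms natrD addrC addKr.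
have sd : (s%:R : R) <= d * n%:R.
  by move: close_m; rewrite sR ler_norml => /andP[h _]; move: h; rewrite -[k%:~R]/(k%:R); lra.
have large : (4000 * 1000 * s <= n)%N.
  rewrite -(ler_nat R) cE -ler_pdivlMl //.
  exact: le_trans sd dn.
have /andP[lo hi] := frac n k s ms large n0 (planar_graphs_neq0 R le_m).
rewrite ger0_norm // (le_trans hi) // -ler_pdivlMr //.
by rewrite ler_pdivrMr // (le_trans sd) // ler_wpM2r // ltW.
Unshelve. all: end_near.
Qed.
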